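(* There exists $n_0\in\mathbb{N}$ with the following property. Suppose $n\in\mathbb{N}$, $p\in(0,1)$ and $\kappa,\lambda\in\mathbb{R}$ satisfy $n\geq n_0$ and, with $N:=c'n\log n$, (C1) $\kappa=3N^{2/5}$, (C2) $np\geq 365N^{2/5}$, and (C3) $\lambda=\min\{np/3,\kappa^2/12\}$. Then any $(n,p,\kappa,\lambda)$-digraph $D$ admits a perfect decomposition. The same conclusion holds if $D$ is an $(n,p,\kappa,\lambda)$-pseudorandom digraph and (C1) and (C2) are replaced by (C$'$1) $\kappa=6(N^2p)^{1/5}$, and (C$'$2) $p\geq n^{-1/3}\log^4 n$ (with (C3) still assumed).
   Context: Digraphs are loopless with at most one edge in each direction between any two distinct vertices. $e_D(v,S)$ (resp. $e_D(S,v)$) is the number of edges of $D$ from $v$ to $S$ (resp. from $S$ to $v$); $e_D(U)$ is the number of edges of $D$ with both endpoints in $U$. The excess at $v$ is $\mathrm{ex}_D(v)=d_D^+(v)-d_D^-(v)$ (outdegree minus indegree), and $\mathrm{ex}(D)=\frac12\sum_{v}|\mathrm{ex}_D(v)|$. Logarithms are natural. Paths and cycles are directed. A perfect decomposition of $D$ is a set $\{P_1,\dots,P_r\}$ of edge-disjoint paths of $D$ that together cover $E(D)$, with $r=\mathrm{ex}(D)$. The constant $c'$: a digraph is Eulerian if $d^+(v)=d^-(v)$ for every vertex $v$ (no connectivity required). It is a known theorem (Knierim, Larcher, Martinsson and Noever) that there is an absolute constant $c'$ such that every Eulerian digraph on $n$ vertices can be decomposed into at most $c'n\log n$ edge-disjoint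 cycles; $c'$ denotes this fixed constant. For $p\in[0,1]$ and $0\leq\lambda,\kappa\leq n$, a digraph $D=(V,E)$ is an $(n,p,\kappa,\lambda)$-digraph if $|V|=n$ and $V$ can be partitioned into three parts $A^+,A^-,A^0$ ($A^0$ may be empty) such that: (P1) for every $v\in A^+$, $\mathrm{ex}_D(v)\geq155\kappa$ and $np/4\leq e_D(v,A^-)\leq np$; (P2) for every $v\in A^-$, $\mathrm{ex}_D(v)\leq-155\kappa$ and $np/4\leq e_D(A^+,v)\leq np$; (P3) for every $v\in A^+\cup A^-$, $e_D(v,A^0)\leq\lambda$ and $e_D(A^0,v)\leq\lambda$; (P4) for every $v\in A^0$, $e_D(A^+,v)\geq np/3$ and $e_D(v,A^-)\geq np/3$. $D$ is an $(n,p,\kappa,\lambda)$-pseudorandom digraph if, additionally, (P5) for every $U\subseteq V$ with $|U|\geq\log n/(50p)$, $e_D(U)\leq100|U|^2p$. *)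

(* Defs.v *)
From HB Require Import structures.
From mathcomp Require Import all_boot all_order all_algebra.
From mathcomp Require Import reals exp.

Set Implicit Arguments.
Unset Strict Implicit.
Unset Printing Implicit Defensive.

Import Order.TTheory GRing.Theory Num.Theory.
Local Open Scope ring_scope.

(* At most one edge in each direction between two vertices; both directions
   may be present simultaneously. *)
Record digraph (V : finType) := Digraph {
  edge :> rel V;
  edge_irr : irreflexive edge
}.

Section Digraphs.

Variables (V : finType) (D : digraph V).

Definition edges_to (v : V) (S : {set V}) : nat := #|[set w in S | D v w]|.

Definition edges_from (S : {set V}) (v : V) : nat := #|[set u in S | D u v]|.

Definition edges_in (U : {set V}) : nat :=
  #|[set a : V * V | [&& a.1 \in U, a.2 \in U & D a.1 a.2]]|.

Definition outdeg (v : V) : nat := #|[set w | D v w]|.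

Definition indeg (v : V) : nat := #|[set u | D u v]|.

Definition excess_at (v : V) : int := (outdeg v)%:Z - (indeg v)%:Z.

Definition excess : rat := 2^-1 * \sum_(v : V) `|excess_at v|%:~R.

Definition eulerian : Prop := forall v : V, outdeg v = indeg v.

(* Paths and cycles are given by their sequences of distinct vertices; the last
   vertex of a cycle is not repeated, so the closing edge is implicit. A path
   has at least one edge. *)
Definition is_path (s : seq V) : bool :=
  [&& (1 < size s)%N, uniq s & sorted D s].

Definition path_edges (s : seq V) : seq (V * V) := zip s (behead s).

Definition is_cycle (s : seq V) : bool :=
  [&& (1 < size s)%N, uniq s & path.cycle D s].

Definition cycle_edges (s : seq V) : seq (V * V) := zip s (rot 1 s).

(* The members of [F], with edges given by [edges_of], are pairwise
   edge-disjoint and together cover the edge set of [D]. *)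
Definition decomposes (edges_of : seq V -> seq (V * V)) (F : seq (seq V)) :
    Prop :=
  pairwise (fun s t => [disjoint edges_of s & edges_of t]) F /\
  (forall u v : V, D u v -> exists2 s, s \in F & (u, v) \in edges_of s).

(* Paths have an edge, so edge-disjoint ones are distinct and [F] is a set. *)
Definition perfect_decomposition (F : seq (seq V)) : Prop :=
  [/\ all is_path F, decomposes path_edges F & (size F)%:R = excess].

Definition cycle_decomposition (F : seq (seq V)) : Prop :=
  all is_cycle F /\ decomposes cycle_edges F.

End Digraphs.

(* c' is a constant for which the theorem of Knierim, Larcher, Martinsson and
   Noever on cycle decompositions of Eulerian digraphs holds. *)
Definition cycle_decomposition_constant (R : realType) (c' : R) : Prop :=
  forall (V : finType) (D : digraph V), eulerian D ->
  exists2 F : seq (seq V), cycle_decomposition D F &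
    (size F)%:R <= c' * #|V|%:R * ln #|V|%:R.

Section PseudorandomDigraphs.

Variables (R : realType) (V : finType).

(* Of the three parts only [A0] may be empty. *)
Definition tripartition (Ap Am A0 : {set V}) : Prop :=
  [/\ Ap != set0, Am != set0,
      [/\ [disjoint Ap & Am], [disjoint Ap & A0] & [disjoint Am & A0]]
    & Ap :|: Am :|: A0 = setT].

Definition P1 (p kappa : R) (D : digraph V) (Ap Am : {set V}) : Prop :=
  forall v : V, v \in Ap ->
    155 * kappa <= (excess_at D v)%:~R /\
    #|V|%:R * p / 4 <= (edges_to D v Am)%:R <= #|V|%:R * p.

Definition P2 (p kappa : R) (D : digraph V) (Ap Am : {set V}) : Prop :=
  forall v : V, v \in Am ->
    (excess_at D v)%:~R <= - (155 * kappa) /\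
    #|V|%:R * p / 4 <= (edges_from D Ap v)%:R <= #|V|%:R * p.

Definition P3 (lambda : R) (D : digraph V) (Ap Am A0 : {set V}) : Prop :=
  forall v : V, v \in Ap :|: Am ->
    (edges_to D v A0)%:R <= lambda /\ (edges_from D A0 v)%:R <= lambda.

Definition P4 (p : R) (D : digraph V) (Ap Am A0 : {set V}) : Prop :=
  forall v : V, v \in A0 ->
    #|V|%:R * p / 3 <= (edges_from D Ap v)%:R /\
    #|V|%:R * p / 3 <= (edges_to D v Am)%:R.

Definition P5 (p : R) (D : digraph V) : Prop :=
  forall U : {set V}, ln #|V|%:R / (50 * p) <= #|U|%:R ->
    (edges_in D U)%:R <= 100 * #|U|%:R ^+ 2 * p.

Definition npkl_digraph (n : nat) (p kappa lambda : R) (D : digraph V) : Prop :=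
  [/\ 0 <= p <= 1, 0 <= lambda <= n%:R, 0 <= kappa <= n%:R, #|V| = n
    & exists Ap Am A0 : {set V},
        [/\ tripartition Ap Am A0, P1 p kappa D Ap Am, P2 p kappa D Ap Am,
            P3 lambda D Ap Am A0 & P4 p D Ap Am A0]].

Definition npkl_pseudorandom (n : nat) (p kappa lambda : R) (D : digraph V) :
    Prop :=
  npkl_digraph n p kappa lambda D /\ P5 p D.

End PseudorandomDigraphs.

(* Main.v *)
Require Import Defs.
From mathcomp Require Import all_boot all_order all_algebra.
From mathcomp Require Import boolp reals sequences exp.
From mathcomp Require Import zify lra.

(* Reserve a sparse subgraph R of edges A+ -> A-, A+ -> A0, A0 -> A-
   in which every vertex keeps about d = n^(1/4 + o(1)) reserved out-edges to A-
   (unless it lies in A-) and reserved in-edges from A+ (unless it lies in A+).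
   R uses up at most the excess of a vertex of A+ or A- and is balanced on A0, so
   D - R splits into
   paths from vertices of positive to vertices of negative excess and an
   Eulerian remainder H, which is a union of O(n log n) cycles.
   A cycle through x and y is absorbed by R: prolong the arcs x..y and y..x
   backwards to A+ and forwards to A- by reserved edges at x and y, which gives
   two paths.  The reserved edges must avoid the arcs they prolong.  Call a
   vertex spent once q of its reserved edges are used, and close the small set
   of spent vertices a bounded number of times under "at least q reserved
   edges into the set"; call the result L.  Reserved edges u w and u' w' whose
   ends occur on the cycle in the order u, u', w, w' also absorb it (split at u
   and w'), and m vertices on a circle span at most 2m pairwise non-crossing
   chords.  Hence a cycle that cannot be absorbed has at most one vertex outside
   L, and two such cycles with distinct outside vertices z, z' and a common
   vertex recombine into an absorbable pair of paths z..z', z'..z plus a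
   remainder inside L.  What survives lives on at most 2 |L| vertices, less than
   half of what we started with, so that decomposing it again into cycles and
   repeating log n times leaves nothing of H. *)

Set Implicit Arguments.
Unset Strict Implicit.
Unset Printing Implicit Defensive.

(** * Edge lists and peeling off paths *)

Section EdgeLists.

Variable V : finType.
Implicit Types (x y u v : V) (s t : seq V) (L : seq (V * V)) (F : seq (seq V)).

(* A single constant for edge counts, whose type arguments have one syntactic
   form, so that [lia] identifies equal counts. *)
Definition cnt (a : pred (V * V)) L : nat := count a L.

Lemma cnt_cat a L1 L2 : cnt a (L1 ++ L2) = cnt a L1 + cnt a L2.
Proof. exact: count_cat. Qed.

Lemma cnt_perm a L1 L2 : perm_eq L1 L2 -> cnt a L1 = cnt a L2.
Proof. by move/permP. Qed.

Lemma perm_cnt L1 L2 : (forall a, cnt a L1 = cnt a L2) -> perm_eq L1 L2.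
Proof. by move=> h; apply/permP. Qed.

Definition outof v : pred (V * V) := fun e => e.1 == v.
Definition into v : pred (V * V) := fun e => e.2 == v.

Lemma path_edges_cat s x t :
  path_edges (s ++ x :: t) = path_edges (rcons s x) ++ path_edges (x :: t).
Proof.
elim: s => [|y [|z s] IH]; rewrite ?cats0 //.
by rewrite /= /path_edges /= in IH *; rewrite IH.
Qed.

Lemma cycle_edges_cons x s : cycle_edges (x :: s) = path_edges (x :: rcons s x).
Proof.
rewrite /cycle_edges /path_edges rot1_cons /=.
have: forall (a : V) t b, zip (a :: t) (rcons t b) = zip (a :: rcons t b) (rcons t b).
  by move=> a t b; elim: t a => //= c t IH a; rewrite IH.
by apply.
Qed.

Lemma cycle_edges_split x s y t :
  cycle_edges (x :: s ++ y :: t) =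
  path_edges (x :: rcons s y) ++ path_edges (y :: rcons t x).
Proof.
by rewrite cycle_edges_cons rcons_cat rcons_cons -cat_cons path_edges_cat.
Qed.

Lemma perm_cycle_edges_rot n s : perm_eq (cycle_edges (rot n s)) (cycle_edges s).
Proof.
rewrite /rot -{3}(cat_take_drop n s).
case: (take n s) => [|x p]; case: (drop n s) => [|y t] //=; rewrite ?cats0 //.
by rewrite !cycle_edges_split perm_catC.
Qed.

Lemma mem_path_edges s e : e \in path_edges s -> e.1 \in s /\ e.2 \in s.
Proof.
case: s => [|x s] //; elim: s x => [|y s IH] x //.
rewrite /path_edges /= inE => /predU1P[-> /=|/IH[]].
  by rewrite !inE !eqxx orbT.
by move=> h1 h2; rewrite [e.1 \in _]in_cons h1 [e.2 \in _]in_cons h2 !orbT.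
Qed.

Lemma mem_cycle_edges s e : e \in cycle_edges s -> e.1 \in s /\ e.2 \in s.
Proof.
case: s => [|x s] //; rewrite cycle_edges_cons => /mem_path_edges.
by rewrite -rcons_cons !mem_rcons !(inE, mem_rcons); case=> /predU1P[->|->] /predU1P[->|->]; rewrite ?eqxx ?orbT.
Qed.

Lemma uniq_path_edges s : uniq s -> uniq (path_edges s).
Proof. exact: zip_uniql. Qed.

Lemma uniq_cycle_edges s : uniq s -> uniq (cycle_edges s).
Proof. exact: zip_uniql. Qed.

Lemma path_all_edges (e : rel V) x s :
  path e x s = all (fun a => e a.1 a.2) (path_edges (x :: s)).
Proof. by elim: s x => //= y s IH x; rewrite IH. Qed.

Definition balanced L :=
  forall v, cnt (outof v) L = cnt (into v) L.

(** The contributions of inner vertices telescope. Both sides are sums because subtraction on [nat]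
    truncates. *)
Lemma path_edges_flow v x s :
  cnt (outof v) (path_edges (x :: s)) + (last x s == v) =
  cnt (into v) (path_edges (x :: s)) + (x == v).
Proof.
elim: s x => [|y s IH] x //=; have := IH y.
rewrite /path_edges /cnt /= -!/(cnt _ _) /outof /into /=; lia.
Qed.

Lemma cycle_edges_balanced s : balanced (cycle_edges s).
Proof.
case: s => [|x s] v //; rewrite cycle_edges_cons.
have := path_edges_flow v x (rcons s x); rewrite last_rcons; lia.
Qed.

Lemma sub_perm (T : eqType) (s t : seq T) :
  uniq s -> {subset s <= t} -> exists r, perm_eq t (s ++ r).
Proof.
elim: s t => [|x s IH] t /=; first by exists t.
case/andP=> xs us sub.
have xt : x \in t by apply: sub; rewrite inE eqxx.
have [|r pr] := IH (rem x t) us.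
  move=> y ys; have: y \in t by apply: sub; rewrite inE ys orbT.
  rewrite (perm_mem (perm_to_rem xt)) inE => /predU1P[yx|//].
  by rewrite -yx ys in xs.
by exists r; rewrite (perm_trans (perm_to_rem xt)) // perm_cons.
Qed.

Definition pedges F := flatten [seq path_edges s | s <- F].

Lemma pedges_cat F1 F2 : pedges (F1 ++ F2) = pedges F1 ++ pedges F2.
Proof. by rewrite /pedges map_cat flatten_cat. Qed.

(** No digraph occurs here: that the steps are edges of [D] is deduced at the end from a permutation
    between [pedges] and the edge list of [D]. *)
Definition goodpath (P N : {set V}) s :=
  if s is x :: p then [&& p != [::], uniq (x :: p), x \in P & last x p \in N]
  else false.

Lemma goodpath_sub (P N P' N' : {set V}) s :
  P \subset P' -> N \subset N' -> goodpath P N s -> goodpath P' N' s.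
Proof.
move=> sP sN; case: s => //= x p /and4P[-> -> /(subsetP sP)-> /(subsetP sN)->].
by [].
Qed.

(** Every edge counted on the left starts in [S], hence also ends there and is counted on the
    right. *)
Lemma out_reachable_flow L (S : {set V}) :
  (forall e, e \in L -> e.1 \in S -> e.2 \in S) ->
  \sum_(v in S) cnt (outof v) L <= \sum_(v in S) cnt (into v) L.
Proof.
have sumcnt (f : V * V -> V) M : \sum_(v in S) count (fun e => f e == v) M = count (fun e => f e \in S) M.
  elim: M => [|e M IH] /=; first by rewrite big1.
  rewrite big_split /= IH; congr addn.
  case: (boolP (f e \in S)) => fS.
    by rewrite (bigD1 (f e)) //= eqxx big1 // => v /andP[_]; rewrite eq_sym => /negbTE->.
  by rewrite big1 // => v vS; case: eqP => // fe; rewrite fe vS in fS.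
move=> cl; rewrite !sumcnt.
rewrite (eq_in_count (a2 := fun e => (e.1 \in S) && (e \in L))) => [|e ->]; last by rewrite andbT.
by apply: sub_count => e /= /andP[eS /cl]; apply.
Qed.

(** The set reachable from [v] receives at least as much as it sends, so the surplus at [v] forces a
    deficit somewhere in it. A walk leading there is shortened to a path. *)
Lemma surplus_path L v :
  cnt (into v) L < cnt (outof v) L ->
  exists p, [/\ uniq (v :: p), {subset path_edges (v :: p) <= L}, p != [::] &
    cnt (outof (last v p)) L < cnt (into (last v p)) L].
Proof.
move=> hv; pose r := [rel x y | (x, y) \in L].
pose S := [set w | connect r v w].
have vS : v \in S by rewrite inE connect0.
have [w wS hw] : exists2 w, w \in S & cnt (outof w) L < cnt (into w) L.
  apply/exists_inP; apply: contraT; rewrite negb_exists_in => /forall_inP none.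
  have cl e : e \in L -> e.1 \in S -> e.2 \in S.
    rewrite !inE => eL c; apply: (connect_trans c); apply: connect1.
    by rewrite /r /= -surjective_pairing.
  have := out_reachable_flow cl; rewrite leqNgt => /negP[].
  rewrite (bigD1 v) //= [X in _ < X](bigD1 v) //= -addSn; apply: leq_add => //.
  by apply: leq_sum => x /andP[xS _]; have := none x xS; rewrite -leqNgt.
move: wS hw; rewrite inE => /connectP[p0 pp0 ->].
case/shortenP: pp0 => p pp up _ hw; exists p; split=> //.
  move: pp; rewrite path_all_edges => /allP h e /h /=.
  by rewrite -surjective_pairing.
by apply: contraTneq hw => ->; rewrite /= -leqNgt ltnW.
Qed.

(** Induction on the number of edges. Removing a path from a surplus vertex to a deficit vertex
    moves both ends one step towards balance and changes no other vertex, so the two sets of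
    admissible ends never grow. *)
Lemma path_peeling L :
  exists F H, [/\ perm_eq L (pedges F ++ H), balanced H &
    all (goodpath [set v | cnt (into v) L < cnt (outof v) L]
           [set v | cnt (outof v) L < cnt (into v) L]) F].
Proof.
elim: {L}(size L) {-2}L (leqnn (size L)) => [|n IH] L szL.
  by exists [::], [::]; case: L szL.
have [/existsP[v hv]|none] := boolP [exists v, cnt (into v) L < cnt (outof v) L]; last first.
  exists [::], L; split=> // v.
  have le x : cnt (outof x) L <= cnt (into x) L.
    by rewrite leqNgt; apply: contra none => h; apply/existsP; exists x.
  apply/eqP; rewrite eqn_leq le leqNgt /=; apply/negP => lt.
  (* Out-degrees and in-degrees have the same total, so without surplus vertices there are no
     deficit vertices either. *)
  have tot (f : V * V -> V) : \sum_v count (fun e => f e == v) L = size L.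
    elim: (L) => [|e M IHM] /=; first by rewrite big1.
    rewrite big_split /= IHM (bigD1 (f e)) //= eqxx big1 // => x.
    by rewrite eq_sym => /negbTE->.
  have tot1 : \sum_x cnt (outof x) L = size L := tot fst.
  have tot2 : \sum_x cnt (into x) L = size L := tot snd.
  have := ltnn (size L); rewrite -{1}tot1 -tot2 (bigD1 v) //=.
  rewrite [X in _ < X](bigD1 v) //= -addSn leq_add //.
  by apply: leq_sum => x _; apply: le.
have [p [up sub pn0 hl]] := surplus_path hv.
have [L' pL] := sub_perm (uniq_path_edges up) sub.
have := perm_size pL; rewrite size_cat => sz.
have szp : 0 < size (path_edges (v :: p)).
  by rewrite /path_edges; case: (p) pn0.
have [|F [H [pF bH gF]]] := IH L'.
  by rewrite -ltnS (leq_trans _ szL) // sz -[X in X < _]add0n ltn_add2r.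
have cL a : cnt a L = cnt a (path_edges (v :: p)) + cnt a L'.
  by rewrite (cnt_perm a pL) cnt_cat.
have vl : v != last v p.
  case: (p) pn0 up => //= y p' _ /andP[vy _].
  by apply: contra vy => /eqP->; rewrite mem_last.
exists ((v :: p) :: F), H; split=> //.
  by rewrite (perm_trans pL) // /pedges /= -catA perm_cat2l.
apply/andP; split; first by rewrite /goodpath pn0 up !inE hv hl.
apply: sub_all gF => s; apply: goodpath_sub; apply/subsetP => w; rewrite !inE.
  have := path_edges_flow w v p; move: hl; rewrite !cL.
  have [<-|_] := eqVneq (last v p) w; first by rewrite (negbTE vl); lia.
  by case: (v == w); lia.
have := path_edges_flow w v p; move: hv; rewrite !cL.
have [<-|_] := eqVneq v w; first by rewrite eq_sym (negbTE vl); lia.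
by case: (last v p == w); lia.
Qed.

End EdgeLists.

(** * The reservoir *)

Lemma double_count (S T : finType) (A : {set S}) (B : {set T}) (P : S -> T -> bool) :
  \sum_(x in A) #|[set y in B | P x y]| = \sum_(y in B) #|[set x in A | P x y]|.
Proof.
transitivity (\sum_(x in A) \sum_(y in B | P x y) 1).
  by apply: eq_bigr => x _; rewrite sum1dep_card.
rewrite (exchange_big_dep (mem B)) /=; last by move=> x y _ /andP[].
by apply: eq_bigr => y yB; rewrite sum1dep_card yB; apply: eq_card => x; rewrite !inE.
Qed.

Section Reservoir.

Variable V : finType.
Implicit Types (x y u v w : V) (R S T : {set V * V}).

Definition outn R v := [set w | (v, w) \in R].
Definition inn R v := [set u | (u, v) \in R].

Lemma mem_outn R v w : (w \in outn R v) = ((v, w) \in R).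
Proof. by rewrite inE. Qed.

Lemma mem_inn R v u : (u \in inn R v) = ((u, v) \in R).
Proof. by rewrite inE. Qed.

Lemma card_sum_outn R : #|R| = \sum_v #|outn R v|.
Proof.
transitivity (\sum_(v in [set: V]) #|[set e in R | e.1 == v]|); last first.
  apply: eq_big => [v|v _]; first by rewrite inE.
  rewrite -(card_imset (mem (outn R v)) (f := fun w => (v, w))); last by move=> ? ? [].
  apply: eq_card => -[a b]; rewrite !inE; apply/andP/imsetP => [[abR /eqP /= av]|[w]].
    by exists b; rewrite ?inE -av.
  by rewrite !inE => vw [-> ->].
rewrite double_count -sum1_card; apply: eq_bigr => e _.
by rewrite -(cards1 e.1); apply: eq_card => v; rewrite !inE eq_sym.
Qed.

Lemma card_sum_inn R : #|R| = \sum_v #|inn R v|.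
Proof.
rewrite -(card_imset (mem R) (f := fun e => (e.2, e.1))); last by move=> [a b] [c d] /= [-> ->].
rewrite (card_sum_outn (imset _ _)); apply: eq_bigr => v _; apply: eq_card => w; rewrite !inE.
apply/imsetP/idP => [[[a b] abR [-> ->]] //|wvR].
by exists (w, v).
Qed.

(* A maximal subgraph with out-degrees at most [d] and in-degrees at most [16 d]
   leaves at most half of [X] unsaturated, so the construction can be iterated. *)
Lemma capped_subgraph (G : rel V) (d delta J : nat) (X : {set V}) :
  #|X| < 2 ^ J -> 2 * d <= delta ->
  (forall x, x \in X -> delta <= #|[set y | G x y]|) ->
  (forall y, #|[set x in X | G x y]| <= 4 * delta) ->
  exists S, [/\ forall x y, (x, y) \in S -> x \in X /\ G x y,
    forall x, x \in X -> #|outn S x| = d & forall y, #|inn S y| <= 16 * d * J].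
Proof.
elim: J X => [|J IH] X cX dd rowX colX.
  have X0 : X = set0 by apply/eqP; rewrite -cards_eq0; lia.
  exists set0; split=> [x y|x|y]; rewrite ?X0 ?inE //.
  by rewrite muln0 leqn0 cards_eq0; apply/eqP/setP => x; rewrite !inE.
have [d0|dpos] := posnP d.
  exists set0; split=> [x y|x _|y]; rewrite ?inE //.
    by rewrite d0; apply/eqP; rewrite cards_eq0; apply/eqP/setP => y; rewrite !inE.
  by rewrite d0 muln0 mul0n leqn0 cards_eq0; apply/eqP/setP => x; rewrite !inE.
pose ok S := [&& [forall e in S, (e.1 \in X) && G e.1 e.2],
  [forall x, #|outn S x| <= d] & [forall y, #|inn S y| <= 16 * d]].
have ok0 : ok set0.
  apply/and3P; split; first by apply/forall_inP => e; rewrite inE.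
    by apply/forallP => x; rewrite (_ : outn _ _ = set0) ?cards0 //; apply/setP => y; rewrite !inE.
  by apply/forallP => x; rewrite (_ : inn _ _ = set0) ?cards0 //; apply/setP => y; rewrite !inE.
case: (arg_maxnP (fun S : {set V * V} => #|S|) ok0) => S /and3P[/forall_inP SG /forallP rowS /forallP colS] maxS.
pose X1 := [set x in X | #|outn S x| < d].
pose Y := [set y | #|inn S y| == 16 * d].
have fullY x y : x \in X1 -> G x y -> y \notin outn S x -> y \in Y.
  rewrite !inE => /andP[xX rx] Gxy nS; apply: contraT => ny.
  have cy : #|inn S y| < 16 * d by rewrite ltn_neqAle ny colS.
  have : ok ((x, y) |: S).
    apply/and3P; split.
    - apply/forall_inP => e; rewrite !inE => /predU1P[->|/SG //].
      by rewrite /= xX Gxy.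
    - apply/forallP => z; have [->|nzx] := eqVneq z x.
        apply: leq_trans rx; rewrite -[_.+1]add1n -(cards1 y).
        apply: leq_trans (leq_card_setU _ _); apply/subset_leq_card/subsetP => w.
        by rewrite !inE xpair_eqE eqxx.
      apply: leq_trans (rowS z); apply/subset_leq_card/subsetP => w.
      by rewrite !inE xpair_eqE (negbTE nzx).
    apply/forallP => z; have [->|nzy] := eqVneq z y.
      apply: leq_trans cy; rewrite -[_.+1]add1n -(cards1 x).
      apply: leq_trans (leq_card_setU _ _); apply/subset_leq_card/subsetP => w.
      by rewrite !inE xpair_eqE eqxx andbT.
    apply: leq_trans (colS z); apply/subset_leq_card/subsetP => w.
    by rewrite !inE xpair_eqE (negbTE nzy) andbF.
  by move/maxS; rewrite cardsU1 nS add1n /= ltnn.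
(* Counting [S] by columns and by rows gives [16 d |Y| <= |S| <= d |X|]. *)
have cardY : 16 * #|Y| <= #|X|.
  rewrite -(leq_pmul2l dpos); apply: leq_trans (_ : #|S| <= _).
    rewrite (card_sum_inn S) (bigID (mem Y)) /= -[X in X <= _]addn0 leq_add //.
    rewrite (eq_bigr (fun=> 16 * d)); last by move=> y; rewrite inE => /eqP.
    by rewrite sum_nat_const; lia.
  rewrite (card_sum_outn S) (bigID (mem X)) /= addnC big1 ?add0n.
    rewrite mulnC -sum_nat_const; exact: leq_sum.
  move=> x nxX; apply/eqP; rewrite cards_eq0; apply/eqP/setP => y; rewrite !inE.
  by apply: contraNF nxX => /SG/andP[].
(* A vertex of [X1] sends at least [delta - d >= delta / 2] edges into [Y], whose vertices receive
   at most [4 delta] each. Hence [|X1| <= 8 |Y| <= |X| / 2]. *)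
have cardX1 : #|X1| <= 8 * #|Y|.
  have dpos' : 0 < delta by lia.
  rewrite -(leq_pmul2r dpos').
  have: \sum_(x in X1) #|[set y in Y | G x y]| <= #|Y| * (4 * delta).
    rewrite double_count -sum_nat_const; apply: leq_sum => y _.
    apply: leq_trans (colX y); apply/subset_leq_card/subsetP => x; rewrite !inE.
    by case/andP=> /andP[-> _] ->.
  have: \sum_(x in X1) delta <= \sum_(x in X1) 2 * #|[set y in Y | G x y]|.
    apply: leq_sum => x xX1; have: x \in X1 by []. rewrite inE => /andP[xX rx].
    have: #|[set y | G x y]| <= #|outn S x| + #|[set y in Y | G x y]|.
      apply: leq_trans (leq_card_setU _ _); apply/subset_leq_card/subsetP => y; rewrite [_ \in [set _ | _]]inE => Gxy.
      rewrite inE; have [//|/(fullY _ _ xX1 Gxy) yY] := boolP (y \in outn S x).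
      by rewrite inE yY Gxy.
    by have := rowX x xX; lia.
  by rewrite sum_nat_const -big_distrr /=; nia.
have [S1 [S1G rowS1 colS1]] : exists S, [/\ forall x y, (x, y) \in S -> x \in X1 /\ G x y,
    forall x, x \in X1 -> #|outn S x| = d & forall y, #|inn S y| <= 16 * d * J].
  apply: IH => // [|x|y]; first by rewrite expnS in cX; lia.
    by rewrite inE => /andP[/rowX].
  apply: leq_trans (colX y); apply/subset_leq_card/subsetP => x; rewrite !inE.
  by case/andP=> /andP[-> _] ->.
(* The incomplete rows of [S] are discarded and replaced by those that the induction builds. *)
exists ([set e in S | e.1 \notin X1] :|: S1); split.
- move=> x y; rewrite in_setU inE => /orP[/andP[/SG/andP[-> ->]] //|/S1G[]].
  by rewrite inE => /andP[-> _].
- move=> x xX; have [xX1|nxX1] := boolP (x \in X1).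
    rewrite -(rowS1 x xX1); apply: eq_card => y.
    by rewrite !mem_outn in_setU in_set /= xX1 andbF.
  have e : outn ([set e in S | e.1 \notin X1] :|: S1) x = outn S x.
    apply/setP => y; rewrite !mem_outn in_setU in_set /= nxX1 andbT.
    by case: ((x, y) \in S) => //=; apply/negbTE; apply: contra nxX1 => /S1G[].
  rewrite e; apply/eqP; rewrite eqn_leq rowS leqNgt /=.
  by apply: contra nxX1; rewrite inE xX.
move=> y; rewrite mulnSr; apply: leq_trans (leq_add (colS1 y) (colS y)).
rewrite addnC; apply: leq_trans (leq_card_setU _ _); apply/subset_leq_card/subsetP => x.
by rewrite !(in_setU, mem_inn) in_set => /orP[/andP[-> _]|->]; rewrite ?orbT.
Qed.

End Reservoir.

Section ReservoirExistence.

Variable V : finType.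
Implicit Types (x y u v w : V) (R S T : {set V * V}).

Definition flip S := [set e | (e.2, e.1) \in S].

Lemma mem_flip S u w : ((u, w) \in flip S) = ((w, u) \in S).
Proof. by rewrite inE. Qed.

Lemma outn_flip S v : outn (flip S) v = inn S v.
Proof. by apply/setP => w; rewrite mem_outn mem_flip mem_inn. Qed.

Lemma inn_flip S v : inn (flip S) v = outn S v.
Proof. by apply/setP => w; rewrite mem_outn mem_inn mem_flip. Qed.

Lemma outnU S T v : outn (S :|: T) v = outn S v :|: outn T v.
Proof. by apply/setP => w; rewrite !(mem_outn, in_setU). Qed.

Lemma innU S T v : inn (S :|: T) v = inn S v :|: inn T v.
Proof. by apply/setP => w; rewrite !(mem_inn, in_setU). Qed.

Lemma cardU_leq (A B : {set V}) a b : #|A| <= a -> #|B| <= b -> #|A :|: B| <= a + b.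
Proof. by move=> hA hB; apply: leq_trans (leq_card_setU _ _) _; apply: leq_add. Qed.

Definition reserve (Ap Am : {set V}) d R :=
  (forall v, v \notin Am -> d <= #|outn R v :&: Am|) /\
  (forall v, v \notin Ap -> d <= #|inn R v :&: Ap|).

(** In the order A+, A0, A- every edge goes strictly up. Hence a balanced list of such edges is
    empty. *)
Definition forward (Ap Am : {set V}) R :=
  forall u w, (u, w) \in R ->
  [/\ u \notin Am, w \notin Ap & (u \in Ap) || (w \in Am)].

(** Four capped subgraphs, two of them reversed by [flip], provide exits of A+, entrances of A-, and
    both for A0. A vertex of A0 gets exactly [d] edges each way, whence the balance. At A+ and A-
    one row and two columns meet, and [d + 2 * 16 d J <= 33 d J]. *)
Lemma reservoir_exists (G : rel V) (Ap Am : {set V}) d delta delta' J :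
  [disjoint Ap & Am] -> 0 < J -> #|V| < 2 ^ J -> 2 * d <= delta -> 2 * d <= delta' ->
  (forall v, v \in Ap -> delta <= #|[set w in Am | G v w]| <= 4 * delta) ->
  (forall v, v \in Am -> delta <= #|[set u in Ap | G u v]| <= 4 * delta) ->
  (forall v, v \in Ap -> #|[set w in ~: (Ap :|: Am) | G v w]| <= 4 * delta') ->
  (forall v, v \in Am -> #|[set u in ~: (Ap :|: Am) | G u v]| <= 4 * delta') ->
  (forall v, v \notin Ap :|: Am -> delta' <= #|[set u in Ap | G u v]|) ->
  (forall v, v \notin Ap :|: Am -> delta' <= #|[set w in Am | G v w]|) ->
  exists R, [/\ forall u w, (u, w) \in R -> G u w, forward Ap Am R, reserve Ap Am d R,
    forall v, v \notin Ap -> v \notin Am -> #|outn R v| = #|inn R v| &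
    forall v, #|outn R v| + #|inn R v| <= 33 * d * J].
Proof.
move=> dis J0 cV dd dd' rowp rowm colp colm row0i row0o.
have cX (X : {set V}) : #|X| < 2 ^ J by apply: leq_ltn_trans cV; apply: max_card.
have disF v : v \in Ap -> v \in Am -> False.
  by move=> vp vm; have := disjointFr dis vp; rewrite vm.
have colle (X Y : {set V}) (H : rel V) D : (forall y, y \in Y -> #|[set x in X | H x y]| <= D) ->
    forall y, #|[set x in X | H x y && (y \in Y)]| <= D.
  move=> h y; have [yY|nyY] := boolP (y \in Y).
    by apply: leq_trans (h y yY); apply/subset_leq_card/subsetP => x; rewrite !inE andbT.
  by rewrite (_ : [set _ in _ | _] = set0) ?cards0 //; apply/setP => x; rewrite !inE !andbF.
have rowge (X Y : {set V}) (H : rel V) D x : x \in X ->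
    (forall x, x \in X -> D <= #|[set y in Y | H x y]|) -> D <= #|[set y | H x y && (y \in Y)]|.
  move=> xX h; apply: leq_trans (h x xX) _; apply/subset_leq_card/subsetP => y.
  by rewrite !inE andbC.
have comm (X Y : {set V}) (H : rel V) D e : #|X| < 2 ^ J -> 2 * d <= e -> D <= 4 * e ->
    (forall x, x \in X -> e <= #|[set y in Y | H x y]|) ->
    (forall y, y \in Y -> #|[set x in X | H x y]| <= D) ->
  exists S, [/\ forall x y, (x, y) \in S -> [/\ x \in X, y \in Y & H x y],
    forall x, x \in X -> #|outn S x| = d & forall y, #|inn S y| <= 16 * d * J].
  move=> hX de De hrow hcol.
  have [||S [h1 h2 h3]] := @capped_subgraph V [rel x y | H x y && (y \in Y)] d e J X hX de.
  - by move=> x xX; exact: (rowge X Y H e x xX hrow).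
  - by move=> y; apply: leq_trans De; apply: (colle X Y H).
  by exists S; split=> // x y /h1 [xX /andP[]].
have pX v : v \notin Ap :|: Am -> v \notin Ap /\ v \notin Am.
  by rewrite inE negb_or => /andP.
have [||S1 [S1G row1 col1]] := comm Ap Am G _ delta (cX _) dd (leqnn _).
- by move=> v /rowp/andP[].
- by move=> v /rowm/andP[].
have [||S2 [S2G row2 col2]] := comm Am Ap [rel x y | G y x] _ delta (cX _) dd (leqnn _).
- by move=> v /rowm/andP[].
- by move=> v /rowp/andP[].
have [||S3 [S3G row3 col3]] := comm (~: (Ap :|: Am)) Ap [rel x y | G y x] _ delta' (cX _) dd' (leqnn _).
- by move=> v; rewrite in_setC => /row0i.
- exact: colp.
have [||S4 [S4G row4 col4]] := comm (~: (Ap :|: Am)) Am G _ delta' (cX _) dd' (leqnn _).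
- by move=> v; rewrite in_setC => /row0o.
- exact: colm.
pose R := (S1 :|: flip S2) :|: (flip S3 :|: S4).
have oR v : outn R v = (outn S1 v :|: inn S2 v) :|: (inn S3 v :|: outn S4 v).
  by rewrite !outnU !outn_flip.
have iR v : inn R v = (inn S1 v :|: outn S2 v) :|: (outn S3 v :|: inn S4 v).
  by rewrite !innU !inn_flip.
have e0 (A : {set V}) : (forall x, x \notin A) -> A = set0.
  by move=> h; apply/setP => x; rewrite !inE (negbTE (h x)).
have oX (X Y : {set V}) (H : rel V) S v : (forall x y, (x, y) \in S -> [/\ x \in X, y \in Y & H x y]) ->
    v \notin X -> outn S v = set0.
  by move=> h nv; apply: e0 => x; rewrite mem_outn; apply: contra nv => /h[].
have iY (X Y : {set V}) (H : rel V) S v : (forall x y, (x, y) \in S -> [/\ x \in X, y \in Y & H x y]) ->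
    v \notin Y -> inn S v = set0.
  by move=> h nv; apply: e0 => x; rewrite mem_inn; apply: contra nv => /h[].
have oIY (X Y : {set V}) (H : rel V) S v : (forall x y, (x, y) \in S -> [/\ x \in X, y \in Y & H x y]) ->
    outn S v :&: Y = outn S v.
  by move=> h; apply/setIidPl/subsetP => w; rewrite mem_outn => /h[].
have nC v : (v \in Ap) || (v \in Am) -> v \notin ~: (Ap :|: Am) by rewrite !inE negbK.
have inR u w : (u, w) \in R = [|| (u, w) \in S1, (w, u) \in S2, (w, u) \in S3 | (u, w) \in S4].
  by rewrite !in_setU !mem_flip -!orbA.
have npm v : v \in Ap -> v \notin Am by move=> a; apply/negP => /(disF _ a).
have nmp v : v \in Am -> v \notin Ap by move=> a; apply/negP => b; apply: (disF _ b a).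
exists R; split.
- by move=> u w; rewrite inR => /or4P[/S1G[]|/S2G[]|/S3G[]|/S4G[]].
- move=> u w; rewrite inR => /or4P[/S1G[]|/S2G[]|/S3G[]|/S4G[]].
  + by move=> a b _; split; rewrite ?a ?npm ?nmp.
  + by move=> a b _; split; rewrite ?a ?b ?npm ?nmp.
  + by rewrite in_setC => /pX[a b] c _; split; rewrite ?c ?npm.
  + by rewrite in_setC => /pX[a b] c _; split; rewrite ?c ?nmp ?orbT.
- split=> v nv.
    have [vp|nvp] := boolP (v \in Ap).
      rewrite -(row1 v vp) -(oIY _ _ _ _ v S1G); apply/subset_leq_card/setSI.
      by rewrite oR -!setUA subsetUl.
    have vX : v \in ~: (Ap :|: Am) by rewrite !inE negb_or nv nvp.
    rewrite -(row4 v vX) -(oIY _ _ _ _ v S4G); apply/subset_leq_card/setSI.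
    by rewrite oR !setUA subsetUr.
  have [vp|nvp] := boolP (v \in Am).
    rewrite -(row2 v vp) -(oIY _ _ _ _ v S2G); apply/subset_leq_card/setSI.
    by rewrite iR [inn S1 v :|: _]setUC -!setUA subsetUl.
  have vX : v \in ~: (Ap :|: Am) by rewrite !inE negb_or nv nvp.
  rewrite -(row3 v vX) -(oIY _ _ _ _ v S3G); apply/subset_leq_card/setSI.
  by rewrite iR [outn S3 v :|: _]setUC !setUA subsetUr.
- move=> v np nm; have vX : v \in ~: (Ap :|: Am) by rewrite !inE negb_or np nm.
  rewrite oR iR (oX _ _ _ _ _ S1G np) (iY _ _ _ _ _ S2G np) (iY _ _ _ _ _ S3G np).
  rewrite (iY _ _ _ _ _ S1G nm) (oX _ _ _ _ _ S2G nm) (iY _ _ _ _ _ S4G nm).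
  by rewrite !set0U setU0 row3 ?row4.
move=> v; have [vp|np] := boolP (v \in Ap).
  have nm := npm v vp; have nv : v \notin ~: (Ap :|: Am) by rewrite nC ?vp.
  rewrite oR iR (iY _ _ _ _ _ S1G nm) (oX _ _ _ _ _ S2G nm) (iY _ _ _ _ _ S4G nm).
  rewrite (oX _ _ _ _ _ S3G nv) (oX _ _ _ _ _ S4G nv) !setU0 cards0 addn0.
  have := cardU_leq (cardU_leq (eq_leq (row1 v vp)) (col2 v)) (col3 v); nia.
have [vm|nm] := boolP (v \in Am).
  have nv : v \notin ~: (Ap :|: Am) by rewrite nC ?vm ?orbT.
  rewrite oR iR (oX _ _ _ _ _ S1G np) (iY _ _ _ _ _ S2G np) (iY _ _ _ _ _ S3G np).
  rewrite (oX _ _ _ _ _ S3G nv) (oX _ _ _ _ _ S4G nv) !setU0 !set0U cards0 add0n.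
  have := cardU_leq (cardU_leq (col1 v) (eq_leq (row2 v vm))) (col4 v); nia.
have vX : v \in ~: (Ap :|: Am) by rewrite !inE negb_or np nm.
rewrite oR iR (oX _ _ _ _ _ S1G np) (iY _ _ _ _ _ S2G np) (iY _ _ _ _ _ S3G np).
rewrite (iY _ _ _ _ _ S1G nm) (oX _ _ _ _ _ S2G nm) (iY _ _ _ _ _ S4G nm).
by rewrite !set0U setU0 row3 ?row4 //; nia.
Qed.

End ReservoirExistence.

(** * Absorbing one cycle *)

Section Absorption.

Variables (V : finType) (Ap Am : {set V}) (R0 : {set V * V}) (q : nat).
Hypothesis dis : [disjoint Ap & Am].
Implicit Types (x y u v w : V) (s pre suf : seq V) (T E B : {set V * V}).

Definition incid T v := #|outn T v| + #|inn T v|.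

Definition spent T := [set v | q <= incid T v].

Definition nbr v := outn R0 v :|: inn R0 v.

(** Stopping the closure after [j] rounds keeps its size within a factor [beta ^ j] of the spent
    set, while a vertex outside round [j.+1] keeps many available edges whose far ends lie outside
    round [j]. *)
Fixpoint lev T j :=
  if j is j'.+1 then lev T j' :|: [set v | q <= #|nbr v :&: lev T j'|] else spent T.

Lemma card_outn_leq T v : #|outn T v| <= #|T|.
Proof. by rewrite (card_sum_outn T) (bigD1 v) //= leq_addr. Qed.

Lemma card_inn_leq T v : #|inn T v| <= #|T|.
Proof. by rewrite (card_sum_inn T) (bigD1 v) //= leq_addr. Qed.

Lemma outnS T T' v : T \subset T' -> outn T v \subset outn T' v.
Proof. by move/subsetP=> sT; apply/subsetP => w; rewrite !mem_outn => /sT. Qed.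

Lemma innS T T' v : T \subset T' -> inn T v \subset inn T' v.
Proof. by move/subsetP=> sT; apply/subsetP => w; rewrite !mem_inn => /sT. Qed.

Lemma spentS T T' : T \subset T' -> spent T \subset spent T'.
Proof.
move=> sT; apply/subsetP => v; rewrite !inE => h; apply: leq_trans h _.
by apply: leq_add; apply: subset_leq_card; [apply: outnS | apply: innS].
Qed.

Lemma levS T T' j : T \subset T' -> lev T j \subset lev T' j.
Proof.
move=> sT; elim: j => [|j IH] /=; first exact: spentS.
apply: setUSS => //; apply/subsetP => v; rewrite !inE => h; apply: leq_trans h _.
by apply/subset_leq_card/setIS.
Qed.

Lemma lev_spent T j : spent T \subset lev T j.
Proof. by elim: j => //= j IH; apply: subset_trans IH (subsetUl _ _). Qed.

Lemma card_spent T : q * #|spent T| <= 2 * #|T|.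
Proof.
rewrite mulnC -sum_nat_const; apply: (@leq_trans (\sum_(v in spent T) incid T v)).
  by apply: leq_sum => v; rewrite inE.
rewrite mul2n -addnn {1}(card_sum_outn T) (card_sum_inn T) -big_split /=.
by rewrite [X in _ <= X](bigID (mem (spent T))) /= leq_addr.
Qed.

(** Counting reserved edges into [L], a round adds at most [Delta |L| / q] vertices, so it
    multiplies the size by at most [1 + Delta / q <= beta]. *)
Lemma card_lev Delta beta T j : 0 < q ->
  (forall v, incid R0 v <= Delta) -> q + Delta <= beta * q ->
  #|lev T j| <= beta ^ j * #|spent T|.
Proof.
move=> q0 hD hb; elim: j => [|j IH]; first by rewrite mul1n.
apply: (@leq_trans (beta * #|lev T j|)); last by rewrite expnS -mulnA leq_mul2l IH orbT.
rewrite -(leq_pmul2l q0) /=; set L := lev T j.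
pose N := [set v | q <= #|nbr v :&: L|].
have: q * #|N| <= #|L| * Delta.
  rewrite mulnC -!sum_nat_const.
  apply: (@leq_trans (\sum_(v in [set: V]) #|[set w in L | w \in nbr v]|)).
    apply: (@leq_trans (\sum_(v in N) #|[set w in L | w \in nbr v]|)).
      apply: leq_sum => v; rewrite inE => h; apply: leq_trans h _; apply/subset_leq_card/subsetP => w.
      by rewrite !inE andbC.
    rewrite [X in _ <= X](eq_bigl predT); last by move=> v; rewrite inE.
    by rewrite [X in _ <= X](bigID (mem N)) /= leq_addr.
  rewrite (double_count [set: V] L (fun v w => w \in nbr v)); apply: leq_sum => w _; apply: leq_trans (hD w).
  apply: leq_trans (leq_card_setU (outn R0 w) (inn R0 w)); apply/subset_leq_card/subsetP => v.
  by rewrite !inE orbC.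
move=> hN; apply: (@leq_trans (q * (#|L| + #|N|))).
  by rewrite leq_mul2l (leq_card_setU L N) orbT.
by move: hN (leq_mul (leqnn #|L|) hb); clear; lia.
Qed.

(** Since [v] is not spent, fewer than [q] of its edges are used, and fewer than [q] lead into
    [lev T j]. *)
Lemma avail_out d T j v : reserve Ap Am d R0 -> v \notin lev T j.+1 -> v \notin Am ->
  d <= #|[set w in Am | ((v, w) \in R0 :\: T) && (w \notin lev T j)]| + 2 * q.
Proof.
case=> h _ /= nl nm; apply: leq_trans (h v nm) _.
move: nl; rewrite inE negb_or => /andP[nl]; rewrite inE -ltnNge => nq.
have : v \notin spent T by apply: contra nl => /(subsetP (lev_spent T j)).
rewrite inE -ltnNge => vs.
have : outn R0 v :&: Am \subset [set w in Am | ((v, w) \in R0 :\: T) && (w \notin lev T j)] :|: (outn T v :|: (nbr v :&: lev T j)).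
  apply/subsetP => w; rewrite !(inE, mem_outn) => /andP[-> ->] /=.
  by case: (_ \in T); case: (_ \in lev T j).
move/subset_leq_card/leq_trans; apply.
apply: leq_trans (cardU_leq (leqnn _) (cardU_leq (leqnn _) (leqnn _))) _.
by rewrite leq_add2l; move: vs nq; rewrite /incid; clear; lia.
Qed.

Lemma avail_in d T j v : reserve Ap Am d R0 -> v \notin lev T j.+1 -> v \notin Ap ->
  d <= #|[set u in Ap | ((u, v) \in R0 :\: T) && (u \notin lev T j)]| + 2 * q.
Proof.
case=> _ h /= nl nm; apply: leq_trans (h v nm) _.
move: nl; rewrite inE negb_or => /andP[nl]; rewrite inE -ltnNge => nq.
have : v \notin spent T by apply: contra nl => /(subsetP (lev_spent T j)).
rewrite inE -ltnNge => vs.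
have : inn R0 v :&: Ap \subset [set w in Ap | ((w, v) \in R0 :\: T) && (w \notin lev T j)] :|: (inn T v :|: (nbr v :&: lev T j)).
  apply/subsetP => w; rewrite !(inE, mem_inn) => /andP[-> ->] /=.
  by case: (_ \in T); case: (_ \in lev T j); rewrite ?orbT.
move/subset_leq_card/leq_trans; apply.
apply: leq_trans (cardU_leq (leqnn _) (cardU_leq (leqnn _) (leqnn _))) _.
by rewrite leq_add2l; move: vs nq; rewrite /incid; clear; lia.
Qed.

(* A reserved route from A+ through [v] to A-: [pre] is at most one vertex, and
   none only if [v] already lies in A+; likewise [suf] and A-. *)
Definition gadget E v pre suf :=
  [&& size pre <= 1, size suf <= 1, all (mem Ap) pre, all (mem Am) suf,
    head v pre \in Ap, last v suf \in Am & all (mem E) (path_edges (pre ++ v :: suf))].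

(** The paths are [px x s1 y sy] and [py y s2 x sx]: each arc is entered by the gadget at its first
    vertex and left by the gadget at its last one. Both gadgets are used completely, and each half
    has to avoid only the arc that it prolongs. *)
Lemma splice_paths E x y s1 s2 px sx py sy :
  gadget E x px sx -> gadget E y py sy ->
  uniq (x :: rcons s1 y) -> uniq (y :: rcons s2 x) ->
  {in px ++ sy, forall u, u \notin x :: rcons s1 y} ->
  {in py ++ sx, forall u, u \notin y :: rcons s2 x} ->
  exists F, all (goodpath Ap Am) F /\
    perm_eq (pedges F) ((path_edges (px ++ x :: sx) ++ path_edges (py ++ y :: sy))
      ++ (path_edges (x :: rcons s1 y) ++ path_edges (y :: rcons s2 x))).
Proof.
have one a b s pa sb : size pa <= 1 -> size sb <= 1 -> all (mem Ap) pa -> all (mem Am) sb ->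
    head a pa \in Ap -> last b sb \in Am -> uniq (a :: rcons s b) ->
    {in pa ++ sb, forall u, u \notin a :: rcons s b} ->
    goodpath Ap Am (pa ++ a :: s ++ b :: sb) /\
    path_edges (pa ++ a :: s ++ b :: sb) =
      path_edges (rcons pa a) ++ path_edges (a :: rcons s b) ++ path_edges (b :: sb).
  move=> szp szs allp alls hd ls us off; split; last first.
    by rewrite path_edges_cat -cat_cons path_edges_cat.
  have ub : uniq (pa ++ (a :: rcons s b) ++ sb).
    have dd u : u \in Ap -> u \notin Am by move=> up; rewrite (disjointFr dis up).
    rewrite cat_uniq cat_uniq us has_cat negb_or.
    have h1 : uniq pa by case: (pa) szp => [|? []].
    have h2 : uniq sb by case: (sb) szs => [|? []].
    rewrite h1 h2 !andTb !andbT -andbA; apply/and3P; split.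
    - apply/hasPn => u ua; apply/negP => upa.
      have : u \notin a :: rcons s b by apply: off; rewrite mem_cat upa.
      by rewrite ua.
    - apply/hasPn => u usb; apply/negP => upa.
      have um : u \in Am := allP alls u usb.
      by have := dd u (allP allp u upa); rewrite um.
    - apply/hasPn => u usb; apply/negP => ua.
      have : u \notin a :: rcons s b by apply: off; rewrite mem_cat usb orbT.
      by rewrite ua.
  have e : pa ++ (a :: rcons s b) ++ sb = pa ++ a :: s ++ b :: sb by rewrite /= cat_rcons.
  rewrite e in ub; case: (pa) hd ub => [|u p'] hd ub; apply/and4P; split=> //.
  - by case: (s).
  - by rewrite last_cat.
  - by case: (p').
  by rewrite last_cat /= last_cat.
move=> /and5P[a1 a2 a3 a4 /and3P[a5 a6 _]] /and5P[b1 b2 b3 b4 /and3P[b5 b6 _]] u1 u2 o1 o2.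
have [g1 e1] := one x y s1 px sy a1 b2 a3 b4 a5 b6 u1 o1.
have [g2 e2] := one y x s2 py sx b1 a2 b3 a4 b5 a6 u2 o2.
exists [:: px ++ x :: s1 ++ y :: sy; py ++ y :: s2 ++ x :: sx]; split.
  by rewrite /= g1 g2.
apply: perm_cnt => a; rewrite /pedges /= e1 e2 cats0.
rewrite !(path_edges_cat px, path_edges_cat py) !cnt_cat.
by clear -a x y s1 s2 px sx py sy; lia.
Qed.

Lemma size_path_edges s : size (path_edges s) = (size s).-1.
Proof. by rewrite size_zip size_behead; case: s => //= x s; apply/minn_idPr. Qed.

Lemma enum_setD_perm E (s : seq (V * V)) : uniq s -> {subset s <= E} ->
  perm_eq (enum E) (s ++ enum (E :\: [set e in s])).
Proof.
move=> us sub; apply: uniq_perm; first exact: enum_uniq.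
  rewrite cat_uniq us enum_uniq andbT /=; apply/hasPn => e.
  by rewrite mem_enum !inE => /andP[].
move=> e; rewrite mem_enum mem_cat mem_enum !inE.
by have [/sub ->|] := boolP (e \in s).
Qed.

(** The bound [q + 8] persists because gadgets touch no spent vertex. Any other vertex has fewer
    than [q] used edges, and the at most four new ones add at most 4 to its out-degree and 4 to its
    in-degree. *)
Lemma absorb_step T x y s1 s2 px sx py sy :
  T \subset R0 ->
  let ge := path_edges (px ++ x :: sx) ++ path_edges (py ++ y :: sy) in
  gadget (R0 :\: T) x px sx -> gadget (R0 :\: T) y py sy ->
  uniq ge -> (forall e, e \in ge -> e.1 \notin spent T /\ e.2 \notin spent T) ->
  uniq (x :: rcons s1 y) -> uniq (y :: rcons s2 x) ->
  {in px ++ sy, forall u, u \notin x :: rcons s1 y} ->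
  {in py ++ sx, forall u, u \notin y :: rcons s2 x} ->
  exists T' F, [/\ [/\ T \subset T', T' \subset R0 & #|T'| <= #|T| + 4],
    forall v, incid T v < q + 8 -> incid T' v < q + 8, all (goodpath Ap Am) F &
    perm_eq (pedges F ++ enum (R0 :\: T'))
      (enum (R0 :\: T) ++ path_edges (x :: rcons s1 y) ++ path_edges (y :: rcons s2 x))].
Proof.
move=> sT ge gx gy uge nsp u1 u2 o1 o2.
have [F [gF pF]] := splice_paths gx gy u1 u2 o1 o2.
have geR : {subset ge <= R0 :\: T}.
  move=> e; rewrite mem_cat; case/and5P: gx => _ _ _ _ /and3P[_ _ /allP hx].
  by case/and5P: gy => _ _ _ _ /and3P[_ _ /allP hy] /orP[/hx|/hy].
pose G := [set e in ge].
have szge : size ge <= 4.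
  case/and5P: gx => a b _ _ _; case/and5P: gy => c d _ _ _.
  by move: a b c d; rewrite size_cat !size_path_edges !size_cat /=; clear; lia.
have cG : #|G| <= 4 by apply: leq_trans szge; rewrite cardsE card_size.
exists (T :|: G), F; split=> //.
- split; first exact: subsetUl.
    rewrite subUset sT; apply/subsetP => e; rewrite inE => /geR.
    by rewrite inE => /andP[].
  by apply: leq_trans (leq_card_setU _ _) _; rewrite leq_add2l.
- move=> v hv; have [vs|] := boolP (v \in spent T).
    have o0 : outn G v = set0.
      apply/setP => w; rewrite mem_outn !inE; apply/negP => /nsp[] /=.
      by rewrite vs.
    have i0 : inn G v = set0.
      apply/setP => w; rewrite mem_inn !inE; apply/negP => /nsp[_] /=.
      by rewrite vs.
    by rewrite /incid outnU innU o0 i0 !setU0.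
  rewrite inE -ltnNge /incid outnU innU => hq.
  have := cardU_leq (leqnn #|outn T v|) (leq_trans (card_outn_leq G v) cG).
  have := cardU_leq (leqnn #|inn T v|) (leq_trans (card_inn_leq G v) cG).
  by move: hq; rewrite /incid; clear; lia.
have pe := enum_setD_perm uge geR.
have eD : R0 :\: (T :|: G) = (R0 :\: T) :\: G by rewrite setDDl.
apply: perm_cnt => a; rewrite eD !cnt_cat (cnt_perm a pe) (cnt_perm a pF) !cnt_cat -/G; exact: addnAC.
Qed.

(** [B] will be the vertex set of one cycle, or of two cycles that are to be recombined. *)
Definition leaver T (B : {set V}) v :=
  exists pre suf, [/\ gadget (R0 :\: T) v pre suf, v \notin spent T &
    {in pre ++ suf, forall u, u \notin B /\ u \notin spent T}].

Lemma gadget_edges E v pre suf e : gadget E v pre suf -> e \in path_edges (pre ++ v :: suf) ->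
  [\/ e.1 = v /\ e.2 \in suf | e.2 = v /\ e.1 \in pre].
Proof.
case/and3P; case: pre => [|u [|? ?]] // _; case: suf => [|w [|? ?]] // _ _ /=;
  rewrite /path_edges /= !inE.
- by move/eqP->; left.
- by move/eqP->; right.
by case/orP=> /eqP->; [right|left].
Qed.

Lemma uniq_gadget E v pre suf : gadget E v pre suf -> v \notin pre -> v \notin suf -> uniq (path_edges (pre ++ v :: suf)).
Proof.
case/and5P=> szp szs allp alls _ vp vs; apply: uniq_path_edges.
rewrite cat_uniq /= vs; have -> /= : uniq pre by case: (pre) szp => [|? []].
have -> : uniq suf by case: (suf) szs => [|? []].
rewrite (negbTE vp) /= andbT; apply/hasPn => u us; apply/negP => up.
have um : u \in Am := allP alls u us.
by have := disjointFr dis (allP allp u up : u \in Ap); rewrite um.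
Qed.

(** The arcs stay in [B] and the gadgets leave it, so the prolonged arcs are simple. A gadget edge
    has exactly one end in [B], namely [x] or [y], so the two gadgets share no edge. *)
Lemma absorb_leavers T (B : {set V}) x y s1 s2 :
  T \subset R0 -> x != y -> leaver T B x -> leaver T B y ->
  {subset x :: rcons s1 y <= B} -> {subset y :: rcons s2 x <= B} ->
  uniq (x :: rcons s1 y) -> uniq (y :: rcons s2 x) ->
  exists T' F, [/\ [/\ T \subset T', T' \subset R0 & #|T'| <= #|T| + 4],
    forall v, incid T v < q + 8 -> incid T' v < q + 8, all (goodpath Ap Am) F &
    perm_eq (pedges F ++ enum (R0 :\: T'))
      (enum (R0 :\: T) ++ path_edges (x :: rcons s1 y) ++ path_edges (y :: rcons s2 x))].
Proof.
move=> sT xy [px [sx [gx xs ox]]] [py [sy [gy ys oy]]] sB1 sB2 u1 u2.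
have xB : x \in B by apply: sB1; rewrite inE eqxx.
have yB : y \in B by apply: sB2; rewrite inE eqxx.
have nx : x \notin px /\ x \notin sx.
  by split; apply/negP => h; have [] := ox x; rewrite ?mem_cat ?h ?orbT // xB.
have ny : y \notin py /\ y \notin sy.
  by split; apply/negP => h; have [] := oy y; rewrite ?mem_cat ?h ?orbT // yB.
have out v pre suf : gadget (R0 :\: T) v pre suf ->
    {in pre ++ suf, forall u, u \notin B /\ u \notin spent T} ->
    forall e, e \in path_edges (pre ++ v :: suf) ->
    (e.1 = v /\ e.2 \notin B /\ e.2 \notin spent T) \/
    (e.2 = v /\ e.1 \notin B /\ e.1 \notin spent T).
  move=> g off e /(gadget_edges g)[[-> h]|[-> h]]; [left|right]; split=> //;
  by apply: off; rewrite mem_cat h ?orbT.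
apply: (absorb_step sT gx gy) => //.
- rewrite cat_uniq (uniq_gadget gx nx.1 nx.2) (uniq_gadget gy ny.1 ny.2) andbT /=.
  apply/hasPn => e /(out y _ _ gy oy) ey; apply/negP => /(out x _ _ gx ox) ex.
  by case: ey => [[e1 [nB _]]|[e1 [nB _]]]; case: ex => [[e2 [nB2 _]]|[e2 [nB2 _]]];
    rewrite ?e1 ?e2 ?xB ?yB // in nB nB2; move: xy; rewrite -e1 -e2 eqxx.
- move=> e; rewrite mem_cat => /orP[/(out x _ _ gx ox)|/(out y _ _ gy oy)].
    by case=> [[-> []]|[-> []]].
  by case=> [[-> []]|[-> []]].
- move=> u; rewrite mem_cat => /orP[h|h]; apply/negP => /sB1.
    by have [|/negbTE->] := ox u; rewrite // mem_cat h.
  by have [|/negbTE->] := oy u; rewrite // mem_cat h orbT.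
move=> u; rewrite mem_cat => /orP[h|h]; apply/negP => /sB2.
  by have [|/negbTE->] := oy u; rewrite // mem_cat h.
by have [|/negbTE->] := ox u; rewrite // mem_cat h orbT.
Qed.

End Absorption.

(** * Crossing chords of a cycle *)

Section Chords.

Variable V : finType.
Implicit Types (u v w : V) (C s : seq V).

Section Positions.

Variable pos : V -> nat.

Definition lowend (e : V * V) := if pos e.1 < pos e.2 then e.1 else e.2.
Definition highend (e : V * V) := if pos e.1 < pos e.2 then e.2 else e.1.

(* Every edge that is not the longest one going up from its low end is the
   only such edge going down from its high end, unless two chords cross. *)
Lemma crossing_chords (M : {set V}) (E : {set V * V}) :
  {in M &, injective pos} ->
  (forall e, e \in E -> [/\ e.1 \in M, e.2 \in M, e.1 != e.2 & (e.2, e.1) \notin E]) ->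
  2 * #|M| < #|E| ->
  exists e e', [/\ e \in E, e' \in E &
    pos (lowend e) < pos (lowend e') < pos (highend e) /\ pos (highend e) < pos (highend e')].
Proof.
move=> injp hE cE.
have lohi e : e \in E -> pos (lowend e) < pos (highend e).
  move=> /hE[m1 m2 n12 _]; rewrite /lowend /highend.
  have [//|//|eq12] := ltngtP (pos e.1) (pos e.2).
  by move: n12; rewrite (injp _ _ m1 m2 eq12) eqxx.
have loM e : e \in E -> lowend e \in M by move=> /hE[m1 m2 _ _]; rewrite /lowend; case: ifP.
have hiM e : e \in E -> highend e \in M by move=> /hE[m1 m2 _ _]; rewrite /highend; case: ifP.
have ext e e' : e \in E -> e' \in E -> lowend e = lowend e' -> highend e = highend e' -> e = e'.
  case: e e' => [a b] [c d] eE e'E; rewrite /lowend /highend /=.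
  have [_ _ _ /=] := hE _ eE; case: ifP => _; case: ifP => _ nfl ? ?; subst=> //;
  by rewrite e'E in nfl.
pose E1 := [set e in E | [forall e' in E, (lowend e' == lowend e) ==> (pos (highend e') <= pos (highend e))]].
have inj1 : {in E1 &, injective lowend}.
  move=> e e'; rewrite !inE => /andP[eE /forall_inP me] /andP[e'E /forall_inP me'] le.
  apply: ext => //; apply: injp; rewrite ?hiM //; apply/eqP; rewrite eqn_leq.
  by rewrite (implyP (me _ e'E)) ?(implyP (me' _ eE)) // le.
have c1 : #|E1| <= #|M|.
  rewrite -(card_in_imset inj1); apply/subset_leq_card/subsetP => v /imsetP[e].
  by rewrite inE => /andP[eE _] ->; apply: loM.
(* More than [2 |M|] edges leave more than [|M|] outside [E1], so two of these share their high
   end. *)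
have /dinjectivePn[e /setDP[eE neE1] [e' /andP[nee /setDP[e'E ne'E1]] hh]] : ~~ dinjectiveb highend (E :\: E1).
  apply: contraTN cE => /dinjectiveP inj2; rewrite -leqNgt -(setID E E1).
  apply: leq_trans (leq_card_setU _ _) _; rewrite mul2n -addnn; apply: leq_add.
    by apply: leq_trans c1; apply/subset_leq_card/subsetIr.
  rewrite -(card_in_imset inj2); apply/subset_leq_card/subsetP => v /imsetP[f].
  by rewrite inE => /andP[_ fE] ->; apply: hiM.
(* The chord [f] has the higher low end and is not in [E1], so some [g] from the same low end goes
   further up. This [g] crosses [f']. *)
have cross f f' : f \in E -> f \notin E1 -> f' \in E -> highend f = highend f' ->
    pos (lowend f') < pos (lowend f) ->
    exists e e', [/\ e \in E, e' \in E &
    pos (lowend e) < pos (lowend e') < pos (highend e) /\ pos (highend e) < pos (highend e')].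
  rewrite inE => fE; rewrite fE negb_forall_in => /exists_inP[g gE].
  rewrite negb_imply -ltnNge => /andP[/eqP lg hg] f'E hf lf.
  exists f', g; split=> //; rewrite lg lf -hf; split=> //.
  exact: lohi.
have [lt|gt|eq] := ltngtP (pos (lowend e)) (pos (lowend e')).
- exact: (cross e' e).
- exact: (cross e e').
case/eqP: nee; apply: ext => //; apply: injp; rewrite ?loM //.
Qed.

End Positions.

(* [e.1], then both [e'.1] and [e.2], then [e'.2] in the cyclic order of [C]. *)
Definition crossing C (e e' : V * V) :=
  exists i s1 s2, [/\ rot i C = e.1 :: s1 ++ e'.2 :: s2, e'.1 \in s1 & e.2 \in s1].

Lemma index_split C a : a \in C -> exists p r, C = p ++ a :: r /\
  forall x, x \in C -> index a C < index x C -> x \in r /\ index x C = (size p).+1 + index x r.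
Proof.
move=> aC; have ltC : index a C < size C by rewrite index_mem.
have eC : C = take (index a C) C ++ a :: drop (index a C).+1 C.
  by rewrite -{2}(nth_index a aC) -drop_nth ?cat_take_drop.
have st : size (take (index a C) C) = index a C by rewrite size_takel // ltnW.
exists (take (index a C) C), (drop (index a C).+1 C); split=> // x xC lt.
have nt : x \notin take (index a C) C.
  apply: contraL lt => xt; rewrite -leqNgt [in index x C]eC index_cat xt.
  by apply: ltnW; apply: leq_trans (_ : size (take (index a C) C) <= _); rewrite ?index_mem ?st.
have nax : a != x by apply: contraTneq lt => ->; rewrite ltnn.
have e : index x C = (index a C).+1 + index x (drop (index a C).+1 C).
  by rewrite [in LHS]eC index_cat (negbTE nt) /= (negbTE nax) st addnS addSn.
split; last by rewrite st.
by move: xC; rewrite [in x \in _]eC mem_cat (negbTE nt) inE eq_sym (negbTE nax).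
Qed.

(** The four ends alternate between the chords, so whatever the directions, the two tails are
    neighbours in the cyclic order of the ends and so are the two heads. The chord whose tail comes
    first takes the role of the first one; four orientations give four rotations. *)
Lemma crossing_rot C e e' : uniq C -> e.1 \in C -> e.2 \in C -> e'.1 \in C -> e'.2 \in C ->
  let pos x := index x C in
  pos (lowend pos e) < pos (lowend pos e') < pos (highend pos e) ->
  pos (highend pos e) < pos (highend pos e') ->
  crossing C e e' \/ crossing C e' e.
Proof.
move=> uC; case: e e' => [u w] [u' w'] /= uC1 wC u'C w'C.
set pos := fun x => index x C; move=> /andP[ab bc] cd.
pose a := lowend pos (u, w); pose b := lowend pos (u', w').
pose c := highend pos (u, w); pose d := highend pos (u', w').
have lC x y : x \in C -> y \in C -> lowend pos (x, y) \in C by rewrite /lowend; case: ifP.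
have hC x y : x \in C -> y \in C -> highend pos (x, y) \in C by rewrite /highend; case: ifP.
have [p1 [r1 [e1 h1]]] := index_split (lC _ _ uC1 wC).
have [bC ib] := h1 _ (lC _ _ u'C w'C) ab.
have [cC ic] := h1 _ (hC _ _ uC1 wC) (ltn_trans ab bc).
have [dC jd] := h1 _ (hC _ _ u'C w'C) (ltn_trans ab (ltn_trans bc cd)).
rewrite /pos ib ic ltn_add2l in bc; rewrite /pos ic jd ltn_add2l in cd.
have [p2 [r2 [e2 h2]]] := index_split bC.
have [cC2 ic2] := h2 _ cC bc; have [dC2 id2] := h2 _ dC (ltn_trans bc cd).
rewrite ic2 id2 ltn_add2l in cd.
have [p3 [r3 [e3 h3]]] := index_split cC2.
have [dC3 _] := h3 _ dC2 cd.
have [p4 [p5 e4]] : exists p4 p5, r3 = p4 ++ d :: p5 by case/splitPr: dC3 => p4 p5; exists p4, p5.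
have {e1 e2 e3 e4} eC : C = p1 ++ a :: p2 ++ b :: p3 ++ c :: p4 ++ d :: p5 by rewrite e1 e2 e3 e4.
have rotC l r : C = l ++ r -> rot (size l) C = r ++ l by move=> ->; rewrite rot_size_cat.
have cA (s t r : seq V) : (s ++ t) ++ r = s ++ t ++ r by rewrite catA.
move: @a @b @c @d eC; rewrite /lowend /highend /=; case: ifP => _; case: ifP => _ /= eC.
- left; exists (size p1), (p2 ++ u' :: p3 ++ w :: p4), (p5 ++ p1); split=> /=.
  + by rewrite (rotC _ _ eC) ?(cat_cons, cA).
  + by rewrite !(mem_cat, inE) eqxx ?orbT.
  + by rewrite !(mem_cat, inE) eqxx ?orbT.
- right; exists (size (p1 ++ u :: p2 ++ w' :: p3 ++ w :: p4)), (p5 ++ p1 ++ u :: p2 ++ w' :: p3), p4; split=> /=.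
  + by rewrite (rotC _ (u' :: p5)) ?eC ?(cat_cons, cA).
  + by rewrite !(mem_cat, inE) eqxx ?orbT.
  + by rewrite !(mem_cat, inE) eqxx ?orbT.
- right; exists (size (p1 ++ w :: p2)), (p3 ++ u :: p4 ++ w' :: p5 ++ p1), p2; split=> /=.
  + by rewrite (rotC _ (u' :: p3 ++ u :: p4 ++ w' :: p5)) ?eC ?(cat_cons, cA).
  + by rewrite !(mem_cat, inE) eqxx ?orbT.
  + by rewrite !(mem_cat, inE) eqxx ?orbT.
left; exists (size (p1 ++ w :: p2 ++ w' :: p3)), (p4 ++ u' :: p5 ++ p1 ++ w :: p2), p3; split=> /=.
+ by rewrite (rotC _ (u :: p4 ++ u' :: p5)) ?eC ?(cat_cons, cA).
+ by rewrite !(mem_cat, inE) eqxx ?orbT.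
+ by rewrite !(mem_cat, inE) eqxx ?orbT.
Qed.

End Chords.

(** Unrolling [m' <= 1 + 2 m / q] bounds [m4] by [1 + 2/q + 4/q^2 + 8/q^3 + 16 n/q^4], which is at
    most [1 + 1/4 + 1/16 + 1/64 + 1/2 < 2]. *)
Lemma fourfold_decay (q n m0 m1 m2 m3 m4 : nat) :
  8 <= q -> 32 * n <= q ^ 4 -> m0 <= n ->
  q * m1 <= q + 2 * m0 -> q * m2 <= q + 2 * m1 ->
  q * m3 <= q + 2 * m2 -> q * m4 <= q + 2 * m3 -> m4 <= 1.
Proof.
rewrite !expnS expn0 muln1 => q8 qn h0 h1 h2 h3 h4.
have {}h2 : q * q * m2 <= q * q + 2 * q + 4 * m0.
  by have := leq_mul (leqnn q) h2; lia.
have {}h3 : q * q * q * m3 <= q * q * q + 2 * (q * q) + 4 * q + 8 * m0.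
  by have := leq_mul (leqnn (q * q)) h3; lia.
have {}h4 : q * q * q * q * m4 <= q * q * q * q + 2 * (q * q * q) + 4 * (q * q) + 8 * q + 16 * m0.
  by have := leq_mul (leqnn (q * q * q)) h4; lia.
rewrite leqNgt; apply/negP => m42.
have k0 := leq_mul (leqnn (q * q * q * q)) m42.
have k1 := leq_mul q8 (leqnn (q * q * q)).
have k2 := leq_mul q8 (leqnn (q * q)).
have k3 := leq_mul q8 (leqnn q).
move: qn q8 h0 h4 k0 k1 k2 k3; clear; rewrite !mulnA; lia.
Qed.

(** * Cycles that cannot be absorbed *)

Section UnabsorbableCycles.

Variables (V : finType) (Ap Am : {set V}) (R0 : {set V * V}) (q d : nat).
Hypothesis dis : [disjoint Ap & Am].
Hypothesis resR : reserve Ap Am d R0.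
Hypothesis dq : 4 * q <= d.
Hypothesis q8 : 8 <= q.
Hypothesis qV : 32 * #|V| <= q ^ 4.
Implicit Types (x y u v w : V) (s pre suf C : seq V) (T E : {set V * V}) (B : {set V}).

Notation spent := (spent q).
Notation lev := (lev R0 q).
Notation leaver := (leaver Ap Am R0 q).

Definition absorbs T T' F (L : seq (V * V)) :=
  [/\ [/\ T \subset T', T' \subset R0 & #|T'| <= #|T| + 4],
    forall v, incid T v < q + 8 -> incid T' v < q + 8, all (goodpath Ap Am) F &
    perm_eq (pedges F ++ enum (R0 :\: T')) (enum (R0 :\: T) ++ L)].

Lemma leaver_intro T B v : v \notin spent T ->
  (v \notin Ap -> exists u, [/\ u \in Ap, (u, v) \in R0 :\: T, u \notin B & u \notin spent T]) ->
  (v \notin Am -> exists w, [/\ w \in Am, (v, w) \in R0 :\: T, w \notin B & w \notin spent T]) ->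
  leaver T B v.
Proof.
move=> vs hp hm.
have [pre [pre1 prep preh preR preB]] : exists pre, [/\ size pre <= 1, all (mem Ap) pre, head v pre \in Ap,
    all (mem (R0 :\: T)) (path_edges (rcons pre v)) & {in pre, forall u, u \notin B /\ u \notin spent T}].
  have [vp|/hp[u [up uR uB us]]] := boolP (v \in Ap); first by exists [::].
  exists [:: u]; split; rewrite ?/= ?up ?uR //.
  by move=> x; rewrite inE => /eqP->.
have [suf [suf1 sufm sufl sufR sufB]] : exists suf, [/\ size suf <= 1, all (mem Am) suf, last v suf \in Am,
    all (mem (R0 :\: T)) (path_edges (v :: suf)) & {in suf, forall u, u \notin B /\ u \notin spent T}].
  have [vm|/hm[u [um uR uB us]]] := boolP (v \in Am); first by exists [::].
  exists [:: u]; split; rewrite ?/= ?um ?uR //.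
  by move=> x; rewrite inE => /eqP->.
exists pre, suf; split=> //.
  by rewrite /gadget pre1 suf1 prep sufm preh sufl path_edges_cat all_cat preR sufR.
by move=> u; rewrite mem_cat => /orP[/preB|/sufB].
Qed.

(** The chords act as gadgets at [u] and [w']: [u] needs no entrance since it is in A+, and [w'] no
    exit since it is in A-. The arc from [u] to [w'] is a path as it stands. The other arc is
    prolonged by [u'] in front and [w] behind, both interior to the first arc and hence off the
    second. *)
Lemma absorb_crossing T C e e' : T \subset R0 -> uniq C ->
  e \in R0 :\: T -> e' \in R0 :\: T ->
  e.1 \in Ap -> e.2 \in Am -> e'.1 \in Ap -> e'.2 \in Am ->
  e.1 \notin spent T -> e.2 \notin spent T -> e'.1 \notin spent T -> e'.2 \notin spent T ->
  crossing C e e' -> exists T' F, absorbs T T' F (cycle_edges C).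
Proof.
case: e e' => [u w] [u' w'] sT uC eR eR' up wm u'p w'm us ws us' ws' [i [s1 [s2 [/= rC u's ws1]]]].
have up' : u \notin Am by rewrite (disjointFr dis up).
have urC : uniq (u :: s1 ++ w' :: s2) by rewrite -rC rot_uniq.
move: (urC); rewrite cons_uniq mem_cat in_cons !negb_or cat_uniq cons_uniq.
case/andP=> /and3P[ns1 nw' ns2] /and3P[uus1 hd /andP[w's2 us2]].
move: hd; rewrite /= negb_or => /andP[w's1 dj].
have nuu' : u != u' by apply: contraNneq ns1 => ->.
have pC : perm_eq (cycle_edges C) (path_edges (u :: rcons s1 w') ++ path_edges (w' :: rcons s2 u)).
  by rewrite -cycle_edges_split -rC perm_sym perm_cycle_edges_rot.
have nos2 x : x \in s1 -> x \notin w' :: rcons s2 u.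
  move=> xs; rewrite inE mem_rcons inE !negb_or.
  apply/and3P; split; first by apply: contraNneq w's1 => <-.
    by apply: contraNneq ns1 => <-.
  by apply: contra dj => xs2; apply/hasP; exists x.
have gu : gadget Ap Am (R0 :\: T) u [::] [:: w].
  by rewrite /gadget /= up wm eR.
have gw : gadget Ap Am (R0 :\: T) w' [:: u'] [::].
  by rewrite /gadget /= u'p w'm eR'.
have [||||||T' [F [h1 h2 h3 h4]]] := @absorb_step V Ap Am R0 q dis T u w' s1 s2 [::] [:: w] [:: u'] [::] sT gu gw.
- by rewrite /= andbT inE xpair_eqE (negbTE nuu').
- by move=> e; rewrite /path_edges /= in_cons mem_seq1 => /orP[] /eqP->.
- by rewrite /= mem_rcons inE negb_or nw' ns1 rcons_uniq w's1 uus1.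
- by rewrite /= mem_rcons inE negb_or eq_sym nw' w's2 rcons_uniq ns2 us2.
- by move=> x; rewrite inE.
- by move=> x; rewrite /= !inE => /orP[] /eqP->; have := nos2 _ u's; have := nos2 _ ws1; rewrite inE.
exists T', F; split=> //.
by rewrite (perm_trans h4) // perm_cat2l perm_sym.
Qed.

(** Restricted to A+ and A- because the chords considered run from A+ to A-. *)
Definition unlev T C j := [set v in C | (v \in Ap :|: Am) && (v \notin lev T j)].

Definition absorbable T C :=
  (exists x y, [/\ x \in C, y \in C, x != y, leaver T [set z in C] x & leaver T [set z in C] y]) \/
  (exists e e', [/\ e \in R0 :\: T, e' \in R0 :\: T,
     [/\ e.1 \in Ap, e.2 \in Am, e'.1 \in Ap & e'.2 \in Am],
     [/\ e.1 \notin spent T, e.2 \notin spent T, e'.1 \notin spent T & e'.2 \notin spent T] &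
     crossing C e e']).

Lemma lev_succ T j : lev T j \subset lev T j.+1.
Proof. exact: subsetUl. Qed.

(** Apart from at most one leaver, a vertex of [C] in A+ or A- outside level [j.+1] has
    [d - 2 q >= 2 q] available edges to the opposite side that end outside level [j]. All of them
    end on [C], as otherwise it would be a leaver too. These chords do not cross, so there are at
    most [2 |M|], and counting their ends gives [2 q |N| <= 4 |M|]. *)
Lemma unlev_step T C j : T \subset R0 -> uniq C -> ~ absorbable T C ->
  q * #|unlev T C j.+1| <= q + 2 * #|unlev T C j|.
Proof.
move=> sT uC nab.
have [A cA hA] : exists2 A : {set V}, #|A| <= 1 & forall v, v \in C -> v \notin A -> ~ leaver T [set z in C] v.
  have [[x [xC lx]]|no] := EM (exists x, x \in C /\ leaver T [set z in C] x).
    exists [set x]; rewrite ?cards1 // => v vC; rewrite inE => vx lv.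
    by apply: nab; left; exists v, x.
  by exists set0; rewrite ?cards0 // => v vC _ lv; apply: no; exists v.
pose M := unlev T C j; pose N := unlev T C j.+1 :\: A.
pose E := [set e in R0 :\: T | [&& e.1 \in Ap, e.2 \in Am, e.1 \in M & e.2 \in M]].
have nAp v : v \in Am -> v \notin Ap by move=> vm; apply/negP => /(disjointFr dis); rewrite vm.
have nAm v : v \in Ap -> v \notin Am by move=> vp; rewrite (disjointFr dis vp).
have nsp v : v \notin lev T j -> v \notin spent T.
  by apply: contra => /(subsetP (lev_spent _ _ _ j)).
have cE : #|E| <= 2 * #|M|.
  rewrite leqNgt; apply/negP => lt.
  have [||e [e' [eE e'E [l1 l2]]]] := crossing_chords (pos := fun x => index x C) _ _ lt.
  - move=> x y; rewrite inE => /andP[xC _]; rewrite inE => /andP[yC _].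
    by move/(congr1 (nth x C)); rewrite !nth_index.
  - move=> e; rewrite inE => /andP[_ /and4P[e1 e2 m1 m2]]; split=> //.
      by apply: contraTneq e1 => ->; apply: nAp.
    by rewrite inE /= (negbTE (nAp _ e2)) andbF.
  move: eE e'E; rewrite !inE -/M => /and4P[/andP[nT eR] e1 e2 /andP[m1 m2]].
  move=> /and4P[/andP[nT' eR'] e1' e2' /andP[m1' m2']].
  have mM v : [&& v \in C, (v \in Ap) || (v \in Am) & v \notin lev T j] -> v \in C /\ v \notin spent T.
    by case/and3P=> vC _ /nsp.
  have {m1}[c1 s1] := mM _ m1; have {m2}[c2 s2] := mM _ m2.
  have {m1'}[c1' s1'] := mM _ m1'; have {m2'}[c2' s2'] := mM _ m2'.
  apply: nab; right; case: (crossing_rot uC c1 c2 c1' c2' l1 l2) => cr.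
    by exists e, e'; split; rewrite // inE ?nT ?nT'.
  by exists e', e; split; rewrite // inE ?nT ?nT'.
have NM v : v \in N -> [/\ v \in C, v \in Ap :|: Am, v \notin lev T j.+1, v \in M & ~ leaver T [set z in C] v].
  rewrite !in_setD => /andP[vA]; rewrite in_set => /and3P[vC vpm vl]; split=> //; last exact: hA.
  by rewrite in_set vC vpm; apply: contra vl => /(subsetP (lev_succ T j)).
have deg v : v \in N -> 2 * q <= incid E v.
  move=> vN; have [vC vpm vl vM nl] := NM v vN.
  have nlj : v \notin lev T j by apply: contra vl => /(subsetP (lev_succ T j)).
  have [vp|nvp] := boolP (v \in Ap).
    have nvm := nAm v vp.
    have sub : [set w in Am | ((v, w) \in R0 :\: T) && (w \notin lev T j)] \subset outn E v.
      apply/subsetP => w; rewrite inE => /and3P[wm vw wl].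
      have wC : w \in C.
        apply: contra_notT nl => wC; apply: leaver_intro; rewrite ?vp ?nsp //.
        by move=> _; exists w; split=> //; [rewrite inE | apply: nsp].
      by rewrite mem_outn inE vw vp wm vM /= inE wC wl inE wm orbT.
    have := avail_out (T := T) resR vl nvm; have := subset_leq_card sub.
    by move: dq; rewrite /incid; clear; lia.
  have vm : v \in Am by move: vpm; rewrite inE (negbTE nvp).
  have sub : [set u in Ap | ((u, v) \in R0 :\: T) && (u \notin lev T j)] \subset inn E v.
    apply/subsetP => u; rewrite inE => /and3P[up uv ul].
    have uC' : u \in C.
      apply: contra_notT nl => uC'; apply: leaver_intro; rewrite ?vm ?nsp //.
      by move=> _; exists u; split=> //; [rewrite inE | apply: nsp].
    by rewrite mem_inn inE uv vm up vM /= inE uC' ul inE up.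
  have := avail_in (T := T) resR vl nvp; have := subset_leq_card sub.
  by move: dq; rewrite /incid; clear; lia.
have cN : 2 * q * #|N| <= 2 * #|E|.
  rewrite mulnC -sum_nat_const; apply: (@leq_trans (\sum_(v in N) incid E v)).
    exact: leq_sum.
  rewrite mul2n -addnn {1}(card_sum_outn E) (card_sum_inn E) -big_split /=.
  by rewrite [X in _ <= X](bigID (mem N)) /=; exact: leq_addr.
have : #|unlev T C j.+1| <= #|N| + 1.
  rewrite -(cardsID A) addnC leq_add2l; apply: leq_trans cA.
  by apply/subset_leq_card/subsetIr.
move: cN cE; rewrite -/M; clear; nia.
Qed.

Lemma unlev4 T C : T \subset R0 -> uniq C -> ~ absorbable T C -> #|unlev T C 4| <= 1.
Proof.
move=> sT uC nab; have st j := unlev_step j sT uC nab.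
have h0 : #|unlev T C 0| <= #|V| by apply: max_card.
exact: (fourfold_decay q8 qV h0 (st 0) (st 1) (st 2) (st 3)).
Qed.

(** On each side that [v] needs, at least [d - 2 q >= 16] available neighbours lie outside level 4,
    and at most two of them are in [B]. This covers [v] in A0 as well. *)
Lemma lev5_leaver T B v : #|[set u in B | (u \in Ap :|: Am) && (u \notin lev T 4)]| <= 2 ->
  v \notin lev T 5 -> leaver T B v.
Proof.
move=> cB nl; have nsp u : u \notin lev T 4 -> u \notin spent T.
  by apply: contra => /(subsetP (lev_spent _ _ _ 4)).
have pick (S : {set V}) (P : pred V) : S \subset Ap :|: Am ->
    3 <= #|[set w in S | P w && (w \notin lev T 4)]| ->
    exists w, [/\ w \in S, P w, w \notin B & w \notin spent T].
  move=> sS h; set W := [set w in S | _] in h.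
  have: ~~ (W \subset [set u in B | (u \in Ap :|: Am) && (u \notin lev T 4)]).
    by apply/negP => /subset_leq_card; move: h cB; clear; lia.
  case/subsetPn => w; rewrite {1}/W in_set => /and3P[wS wP wl] nw.
  exists w; split; rewrite ?nsp //; apply: contra nw => wB.
  by rewrite inE wB wl andbT (subsetP sS).
apply: leaver_intro.
- by apply: nsp; apply: contra nl => /(subsetP (lev_succ T 4)).
- move=> nvp; apply: (pick Ap (fun u => (u, v) \in R0 :\: T)); first exact: subsetUl.
  by have := avail_in (T := T) resR nl nvp; move: dq q8; clear; lia.
move=> nvm; apply: (pick Am (fun w => (v, w) \in R0 :\: T)); first exact: subsetUr.
by have := avail_out (T := T) resR nl nvm; move: dq q8; clear; lia.
Qed.

End UnabsorbableCycles.

(** * Absorbing many cycles *)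

Section Recombine.

Variable V : finType.
Implicit Types (x y u v w z : V) (s C : seq V).

Lemma first_in (P : pred V) s : has P s ->
  exists s1 v s2, [/\ s = s1 ++ v :: s2, P v & ~~ has P s1].
Proof.
by move=> h; case: (split_find h) => v s1 s2 Pv nh; exists s1, v, s2; rewrite cat_rcons.
Qed.

(* Follow each cycle from its [z] up to its first vertex on the other cycle,
   then switch; the two unused arcs close up into a closed walk. *)
Lemma recombine_cycles C1 C2 z1 z2 v : uniq C1 -> uniq C2 ->
  z1 \in C1 -> z2 \in C2 -> z1 \notin C2 -> z2 \notin C1 -> v \in C1 -> v \in C2 ->
  exists s1 s2 H, [/\ perm_eq (cycle_edges C1 ++ cycle_edges C2)
      (path_edges (z1 :: rcons s1 z2) ++ path_edges (z2 :: rcons s2 z1) ++ H),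
    uniq (z1 :: rcons s1 z2) /\ uniq (z2 :: rcons s2 z1),
    {subset z1 :: rcons s1 z2 <= C1 ++ C2} /\ {subset z2 :: rcons s2 z1 <= C1 ++ C2},
    balanced H &
    forall e, e \in H -> [/\ e.1 \in C1 ++ C2, e.1 \notin [:: z1; z2], e.2 \in C1 ++ C2 & e.2 \notin [:: z1; z2]]].
Proof.
move=> uC1 uC2 z1C1 z2C2 z1C2 z2C1 vC1 vC2.
case: (rot_to z1C1) => i1 a rC1; case: (rot_to z2C2) => i2 b rC2.
have pE : perm_eq (cycle_edges C1 ++ cycle_edges C2) (path_edges (z1 :: rcons a z1) ++ path_edges (z2 :: rcons b z2)).
  by rewrite -!cycle_edges_cons -rC1 -rC2 perm_sym; apply: perm_cat; apply: perm_cycle_edges_rot.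
have m1 x : (x \in C1) = (x \in z1 :: a) by rewrite -rC1 mem_rot.
have m2 x : (x \in C2) = (x \in z2 :: b) by rewrite -rC2 mem_rot.
have ua : uniq (z1 :: a) by rewrite -rC1 rot_uniq.
have ub : uniq (z2 :: b) by rewrite -rC2 rot_uniq.
have [|a1 [t [a2 [ea tC2 na1]]]] := @first_in (mem C2) a.
  apply/hasP; exists v => //; move: vC1; rewrite m1 inE => /predU1P[vz|//].
  by rewrite -vz vC2 in z1C2.
have [|b1 [t' [b2 [eb t'C1 nb1]]]] := @first_in (mem C1) b.
  apply/hasP; exists v => //; move: vC2; rewrite m2 inE => /predU1P[vz|//].
  by rewrite -vz vC1 in z2C1.
move: tC2 t'C1; rewrite /= m1 m2 ea eb => tC2 t'C1.
have sub1 x : x \in z1 :: a -> x \in C1 ++ C2 by rewrite -m1 mem_cat => ->.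
have sub2 x : x \in z2 :: b -> x \in C1 ++ C2 by rewrite -m2 mem_cat orbC => ->.
have na x : x \in z1 :: a -> x \notin b1 /\ x != z2.
  rewrite -m1 => xC; split; last by apply: contraNneq z2C1 => <-.
  by apply: contra nb1 => xb; apply/hasP; exists x.
have nb x : x \in z2 :: b -> x \notin a1 /\ x != z1.
  rewrite -m2 => xC; split; last by apply: contraNneq z1C2 => <-.
  by apply: contra na1 => xb; apply/hasP; exists x.
(* Both new paths have this shape: one cycle up to [y], then the other. The part before [y] avoids
   the second cycle. *)
have mix (z z' : V) p p' r r' y : uniq (z :: p ++ y :: r) -> uniq (z' :: p' ++ y :: r') ->
    (forall x, x \in z' :: p' ++ y :: r' -> x \notin p /\ x != z) -> uniq (z :: rcons (p ++ y :: r') z').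
  move=> u1 u2 off; rewrite -rcons_cons rcons_uniq -cat_cons mem_cat cat_uniq.
  have [o1 o2] := off z' (mem_head _ _).
  have offr x : x \in y :: r' -> x \notin z :: p.
    move=> xr; have [|h1 h2] := off x; first by rewrite in_cons mem_cat xr !orbT.
    by rewrite in_cons (negbTE h1) orbF.
  move: u2; rewrite -cat_cons cons_uniq mem_cat negb_or cat_uniq => /andP[/andP[_ nz'] /and3P[_ _ ->]].
  move: u1; rewrite -cat_cons cat_uniq => /and3P[-> _ _].
  have nzp : z' \notin z :: p by rewrite in_cons negb_or o2 o1.
  rewrite (negbTE nzp) (negbTE nz') !andTb andbT.
  by apply/hasPn => x /offr.
(* When the switching points agree, the two new paths use every edge and nothing is left over. *)
have [tt'|tt'] := eqVneq t t'.
  subst t'; exists (a1 ++ t :: b2), (b1 ++ t :: a2), [::]; split=> //.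
  - rewrite (perm_trans pE) // ea eb !rcons_cat !rcons_cons -!cat_cons !path_edges_cat cats0.
    by apply: perm_cnt => c; rewrite !cnt_cat; clear; lia.
  - by split; [apply: (mix _ _ _ b1 a2 b2) | apply: (mix _ _ _ a1 b2 a2)];
      rewrite -?ea -?eb.
  split=> x; rewrite -rcons_cons mem_rcons in_cons -cat_cons mem_cat => /orP[/eqP->|/orP[h|h]].
  - exact/sub2/mem_head.
  - by apply: sub1; rewrite ea -cat_cons mem_cat h.
  - by apply: sub2; rewrite eb in_cons mem_cat h !orbT.
  - exact/sub1/mem_head.
  - by apply: sub2; rewrite eb -cat_cons mem_cat h.
  - by apply: sub1; rewrite ea in_cons mem_cat h !orbT.
(* On the first cycle [t] is the first vertex shared with the second, so the shared vertex [t']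
   comes after it. *)
have t'a2 : t' \in a2.
  have : t' \notin a1 /\ t' != z1 by apply: nb; rewrite eb in_cons mem_cat inE eqxx !orbT.
  move: t'C1; rewrite in_cons mem_cat in_cons => /or4P[/eqP->|h1|/eqP h2|//] [].
  - by rewrite eqxx.
  - by rewrite h1.
  - by rewrite h2 eqxx in tt'.
have tb2 : t \in b2.
  have : t \notin b1 /\ t != z2 by apply: na; rewrite ea in_cons mem_cat inE eqxx !orbT.
  move: tC2; rewrite in_cons mem_cat in_cons => /or4P[/eqP->|h1|/eqP h2|//] [].
  - by rewrite eqxx.
  - by rewrite h1.
  - by rewrite h2 eqxx in tt'.
have [a3 [a4 ea2]] : exists a3 a4 : seq V, a2 = a3 ++ t' :: a4.
  by case/splitPr: t'a2 => l r; exists l, r.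
have [b3 [b4 eb2]] : exists b3 b4 : seq V, b2 = b3 ++ t :: b4.
  by case/splitPr: tb2 => l r; exists l, r.
rewrite ea2 in ea; rewrite eb2 in eb.
have ea' : a = (a1 ++ t :: a3) ++ t' :: a4 by rewrite ea -catA.
have eb' : b = (b1 ++ t' :: b3) ++ t :: b4 by rewrite eb -catA.
have nz x : x \in t :: a3 -> (x \in C1 ++ C2) && (x \notin [:: z1; z2]).
  move=> h; have xa : x \in a by rewrite ea' !mem_cat h orbT.
  have xza : x \in z1 :: a by rewrite in_cons xa orbT.
  have [_ nx] := na x xza; rewrite (sub1 x xza) !in_cons in_nil (negbTE nx) !orbF /=.
  by apply: contraTneq xa => ->; case/andP: ua.
have nz' x : x \in t' :: b3 -> (x \in C1 ++ C2) && (x \notin [:: z1; z2]).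
  move=> h; have xa : x \in b by rewrite eb' !mem_cat h orbT.
  have xza : x \in z2 :: b by rewrite in_cons xa orbT.
  have [_ nx] := nb x xza; rewrite (sub2 x xza) !in_cons in_nil (negbTE nx) !orbF /=.
  by apply: contraTneq xa => ->; case/andP: ub.
(* The arcs from [t] to [t'] and back form a closed walk that may repeat vertices; only its balance
   is claimed. *)
exists (a1 ++ t :: b4), (b1 ++ t' :: a4), (cycle_edges (t :: a3 ++ t' :: b3)); split=> //.
- rewrite (perm_trans pE) // cycle_edges_split ea eb.
  rewrite !(rcons_cat, rcons_cons) -!cat_cons !path_edges_cat.
  rewrite -!cat_cons !path_edges_cat.
  apply: perm_cnt => c; rewrite !cnt_cat !rcons_cons.
  pose f x s y := cnt c (path_edges (x :: rcons s y)).
  rewrite -!/(f _ _ _).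
  move: (f z1 a1 t) (f t a3 t') (f t' a4 z1) (f z2 b1 t') (f t' b3 t) (f t b4 z2).
  by clear; lia.
- by split; [apply: (mix _ _ _ (b1 ++ t' :: b3) (a3 ++ t' :: a4) b4)
         | apply: (mix _ _ _ (a1 ++ t :: a3) (b3 ++ t :: b4) a4)];
    rewrite -?ea -?eb -?ea' -?eb'.
- split=> x; rewrite -rcons_cons mem_rcons in_cons -cat_cons mem_cat => /orP[/eqP->|/orP[h|h]].
  + exact/sub2/mem_head.
  + by apply: sub1; rewrite ea -cat_cons mem_cat h.
  + by apply: sub2; rewrite eb' in_cons mem_cat h !orbT.
  + exact/sub1/mem_head.
  + by apply: sub2; rewrite eb -cat_cons mem_cat h.
  + by apply: sub1; rewrite ea' in_cons mem_cat h !orbT.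
- exact: cycle_edges_balanced.
have nzz x : x \in t :: a3 ++ t' :: b3 -> (x \in C1 ++ C2) && (x \notin [:: z1; z2]).
  by rewrite -cat_cons mem_cat => /orP[/nz|/nz'].
by move=> e /mem_cycle_edges[/nzz/andP[-> ->] /nzz/andP[-> ->]].
Qed.

End Recombine.

(** * Absorbing a family of cycles *)

Section AbsorbCycles.

Variables (V : finType) (Ap Am : {set V}) (R0 : {set V * V}) (q d : nat).
Hypothesis dis : [disjoint Ap & Am].
Hypothesis resR : reserve Ap Am d R0.
Hypothesis dq : 4 * q <= d.
Hypothesis q8 : 8 <= q.
Hypothesis qV : 32 * #|V| <= q ^ 4.
Implicit Types (x y u v w z : V) (s pre suf C : seq V) (T E : {set V * V}) (B : {set V}) (cs : seq (seq V)).

Notation lev := (lev R0 q).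
Notation absorbable := (absorbable Ap Am R0 q).
Notation absorbs := (absorbs Ap Am R0 q).

Lemma absorb_absorbable T C : T \subset R0 -> uniq C -> absorbable T C ->
  exists T' F, absorbs T T' F (cycle_edges C).
Proof.
move=> sT uC [[x [y [xC yC xy lx ly]]]|[e [e' [eR e'R [h1 h2 h3 h4] [h5 h6 h7 h8] cr]]]]; last first.
  exact: (absorb_crossing dis sT uC eR e'R).
case: (rot_to xC) => i s rC; have ys : y \in s.
  have : y \in rot i C by rewrite mem_rot.
  by rewrite rC in_cons eq_sym (negbTE xy).
have [s1 [s2 es]] : exists s1 s2 : seq V, s = s1 ++ y :: s2.
  by case/splitPr: ys => l r; exists l, r.
rewrite es in rC; have uxC : uniq (x :: s1 ++ y :: s2) by rewrite -rC rot_uniq.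
have uyC : uniq (y :: s2 ++ x :: s1).
  by rewrite -cat_cons uniq_catC.
have mC z : (z \in C) = (z \in x :: s1 ++ y :: s2) by rewrite -rC mem_rot.
have pC : perm_eq (cycle_edges C) (path_edges (x :: rcons s1 y) ++ path_edges (y :: rcons s2 x)).
  by rewrite -cycle_edges_split -rC perm_sym perm_cycle_edges_rot.
have [||||T' [F [h1 h2 h3 h4]]] := absorb_leavers (s1 := s1) (s2 := s2) dis sT xy lx ly.
- move=> z; rewrite in_set mC -rcons_cons mem_rcons -cat_cons mem_cat !in_cons.
  by case/predU1P=> [->|->] //; rewrite eqxx orbT.
- move=> z; rewrite in_set mC -rcons_cons mem_rcons -cat_cons mem_cat !in_cons.
  by case/or3P=> ->; rewrite ?orbT.
- move: uxC; rewrite -[y :: s2]cat1s catA -cat_cons cat_uniq => /and3P[+ _ _].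
  by rewrite cats1.
- move: uyC; rewrite -[x :: s1]cat1s catA -cat_cons cat_uniq => /and3P[+ _ _].
  by rewrite cats1.
exists T', F; split=> //; rewrite (perm_trans h4) // perm_cat2l perm_sym //.
Qed.

Definition proper_cycles cs := all (fun C => (1 < size C) && uniq C) cs.

(** Choose for each outside vertex [z] a cycle through it and another vertex [phi z] on that cycle.
    The latter lies in [L], because a cycle has only one outside vertex, and it determines [z],
    because cycles with a common vertex have the same outside vertex. So there are at most [|L|]
    outside vertices. *)
Lemma final_cover (L : {set V}) cs : proper_cycles cs ->
  (forall C x y, C \in cs -> x \in C -> y \in C -> x \notin L -> y \notin L -> x = y) ->
  (forall C1 C2 z1 z2 v, C1 \in cs -> C2 \in cs -> z1 \in C1 -> z2 \in C2 ->
     z1 \notin L -> z2 \notin L -> v \in C1 -> v \in C2 -> z1 = z2) ->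
  exists2 W : {set V}, #|W| <= 2 * #|L| & L \subset W /\
    forall C x, C \in cs -> x \in C -> x \in W.
Proof.
move=> pcs one cross.
pose Z := [set z | (z \notin L) && has (fun C => z \in C) cs].
pose cyc z : seq V := nth [::] cs (find (fun C : seq V => z \in C) cs).
(* The default [z] is never taken, since a proper cycle has a second vertex. *)
pose phi z := head z [seq x <- cyc z | x != z].
have cycP z : z \in Z -> cyc z \in cs /\ z \in cyc z.
  rewrite inE => /andP[_ h]; split; last exact: (nth_find [::] h).
  by rewrite mem_nth // -has_find.
have phiP z : z \in Z -> phi z \in cyc z /\ phi z != z.
  move=> zZ; have [cz zc] := cycP z zZ; have /andP[sz uz] := allP pcs _ cz.
  have: 0 < size [seq x <- cyc z | x != z].
    rewrite size_filter -has_count; apply: contraTT sz => /hasPn h.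
    rewrite -leqNgt; apply: (@uniq_leq_size _ _ [:: z]) => // x /h.
    by rewrite negbK inE.
  rewrite /phi; case E : [seq _ <- _ | _] => [//|a r] _ /=.
  have : a \in [seq x <- cyc z | x != z] by rewrite E mem_head.
  by rewrite mem_filter => /andP[].
have inj : {in Z &, injective phi}.
  move=> z z' zZ z'Z eq; have [cz zc] := cycP z zZ; have [cz' zc'] := cycP z' z'Z.
  have [pz _] := phiP z zZ; have [pz' _] := phiP z' z'Z; rewrite -eq in pz'.
  move: zZ z'Z; rewrite !inE => /andP[zL _] /andP[z'L _].
  exact: (cross _ _ _ _ (phi z) cz cz' zc zc' zL z'L pz pz').
have cZ : #|Z| <= #|L|.
  rewrite -(card_in_imset inj); apply/subset_leq_card/subsetP => x /imsetP[z zZ ->].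
  have [cz zc] := cycP z zZ; have [pz nz] := phiP z zZ.
  apply: contraNT nz => pL; apply/eqP; apply: (one (cyc z)) => //.
  by move: zZ; rewrite inE => /andP[].
exists (L :|: Z); last split; first by rewrite mul2n -addnn; apply: cardU_leq.
  exact: subsetUl.
move=> C x cC xC; rewrite in_setU; have [//|nL] := boolP (x \in L).
by rewrite inE nL /=; apply/hasP; exists C.
Qed.

Lemma perm_chain T T1 T2 (F1 F2 : seq (seq V)) (L1 L2 H : seq (V * V)) :
  perm_eq (pedges F1 ++ enum (R0 :\: T1)) (enum (R0 :\: T) ++ L1) ->
  perm_eq (pedges F2 ++ enum (R0 :\: T2) ++ H) (enum (R0 :\: T1) ++ L2) ->
  perm_eq (pedges (F1 ++ F2) ++ enum (R0 :\: T2) ++ H) (enum (R0 :\: T) ++ L1 ++ L2).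
Proof.
move=> p1 p2; apply: perm_cnt => a; have := cnt_perm a p1; have := cnt_perm a p2.
by rewrite pedges_cat !cnt_cat; clear; lia.
Qed.

(** Induction on the number of cycles: a step removes one absorbable cycle, or two cycles that
    recombine, at the price of four reserved edges. The remainder [Hd] accumulates inside level 5,
    which only grows with [T]. When no step applies, [final_cover] confines the surviving cycles. *)
Lemma absorb_cycles cs T Hd : T \subset R0 -> proper_cycles cs ->
  balanced Hd -> (forall e, e \in Hd -> e.1 \in lev T 5 /\ e.2 \in lev T 5) ->
  (forall v, incid T v < q + 8) ->
  exists T' F H (W : {set V}), [/\ [/\ T \subset T', T' \subset R0 & #|T'| <= #|T| + 4 * size cs],
    forall v, incid T' v < q + 8,
    [/\ balanced H, forall e, e \in H -> e.1 \in W /\ e.2 \in W & #|W| <= 2 * #|lev T' 5|],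
    all (goodpath Ap Am) F &
    perm_eq (pedges F ++ enum (R0 :\: T') ++ H)
      (enum (R0 :\: T) ++ flatten [seq cycle_edges C | C <- cs] ++ Hd)].
Proof.
elim: {cs}(size cs) {-2}cs (leqnn (size cs)) T Hd => [|n IH] cs szn T Hd sT pcs bHd lHd hT.
  case: cs szn pcs => // _ _; exists T, [::], Hd, (lev T 5); split=> //=.
    by split; rewrite ?addn0.
  by split=> //; clear; lia.
(* Both kinds of step end alike: [P] is absorbed, [H0] joins the remainder and the induction treats
   [cs']. *)
have next (P : seq (V * V)) T1 F1 cs' H0 : (forall C, C \in cs' -> C \in cs) -> size cs' <= n -> size cs' < size cs ->
    perm_eq (flatten [seq cycle_edges C | C <- cs]) (P ++ flatten [seq cycle_edges C | C <- cs'] ++ H0) ->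
    absorbs T T1 F1 P -> balanced H0 ->
    (forall e, e \in H0 -> e.1 \in lev T 5 /\ e.2 \in lev T 5) ->
    exists T' F H (W : {set V}), [/\ [/\ T \subset T', T' \subset R0 & #|T'| <= #|T| + 4 * size cs],
    forall v, incid T' v < q + 8,
    [/\ balanced H, forall e, e \in H -> e.1 \in W /\ e.2 \in W & #|W| <= 2 * #|lev T' 5|],
    all (goodpath Ap Am) F &
    perm_eq (pedges F ++ enum (R0 :\: T') ++ H)
      (enum (R0 :\: T) ++ flatten [seq cycle_edges C | C <- cs] ++ Hd)].
  move=> sub szn' szlt pC [[sT1 sR1 cT1] hT1 gF1 pF1] bH0 lH0.
  have pcs' : proper_cycles cs' by apply/allP => D /sub; apply: (allP pcs).
  have bH : balanced (H0 ++ Hd).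
    by move=> v; rewrite !cnt_cat; congr addn; [apply: bH0 | apply: bHd].
  have lH e : e \in H0 ++ Hd -> e.1 \in lev T1 5 /\ e.2 \in lev T1 5.
    rewrite mem_cat; have /subsetP s5 := levS R0 q 5 sT1.
    by case/orP=> [/lH0|/lHd] [/s5 -> /s5 ->].
  have [T' [F [H [W [[sT' sR' cT'] hT' hW gF pF]]]]] := IH cs' szn' T1 (H0 ++ Hd) sR1 pcs' bH lH (fun v => hT1 v (hT v)).
  exists T', (F1 ++ F), H, W; split=> //.
  - split=> //; first exact: subset_trans sT'.
    by move: cT' cT1 szlt; clear; lia.
  - by rewrite all_cat gF1.
  apply: perm_trans (perm_chain pF1 pF) _; rewrite perm_cat2l.
  apply: perm_cnt => a; have := cnt_perm a pC; rewrite !cnt_cat; clear; lia.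
have flat_rem C cs1 : C \in cs1 -> perm_eq (flatten [seq cycle_edges C | C <- cs1])
    (cycle_edges C ++ flatten [seq cycle_edges C | C <- rem C cs1]).
  by move=> CC; have := perm_flatten (perm_map (@cycle_edges V) (perm_to_rem CC)).
have [[C [Ccs aC]]|noabs] := EM (exists C, C \in cs /\ absorbable T C).
  have /andP[_ uC] := allP pcs C Ccs.
  have [T1 [F1 a1]] := absorb_absorbable sT uC aC.
  have szc : size cs = (size (rem C cs)).+1 by rewrite (perm_size (perm_to_rem Ccs)).
  apply: (next (cycle_edges C) T1 F1 (rem C cs) [::]) => //.
  - by move=> D; apply: mem_rem.
  - by move: szn; rewrite szc.
  - by rewrite szc.
  by rewrite cats0; apply: flat_rem.
have nabs C : C \in cs -> ~ absorbable T C by move=> Ccs aC; apply: noabs; exists C.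
have un4 C : C \in cs -> #|unlev Ap Am R0 q T C 4| <= 1.
  move=> Ccs; have /andP[_ uC] := allP pcs C Ccs.
  exact: (unlev4 dis resR dq q8 qV sT uC (nabs C Ccs)).
(* Two vertices of one cycle outside level 5 would both be leavers, making the cycle absorbable. *)
have one C x y : C \in cs -> x \in C -> y \in C -> x \notin lev T 5 -> y \notin lev T 5 -> x = y.
  move=> Ccs xC yC xl yl; apply/eqP; apply: contra_notT (nabs C Ccs) => nxy.
  have c2 : #|[set u in [set z in C] | (u \in Ap :|: Am) && (u \notin lev T 4)]| <= 2.
    apply: leq_trans (leqW (un4 C Ccs)); apply/subset_leq_card/subsetP => u.
    by rewrite !inE.
  by left; exists x, y; split=> //; apply: (lev5_leaver resR dq q8 c2).
have [[C1 [C2 [z1 [z2 [v [[C1cs C2cs] [z1C1 z2C2] [z1l z2l] [vC1 vC2] nz]]]]]]|nocross] :=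
  EM (exists C1 C2 z1 z2 v, [/\ C1 \in cs /\ C2 \in cs, z1 \in C1 /\ z2 \in C2,
    z1 \notin lev T 5 /\ z2 \notin lev T 5, v \in C1 /\ v \in C2 & z1 != z2]); last first.
  have [|W cW [sW hW]] := final_cover pcs one.
    move=> C1 C2 z1 z2 v *; apply/eqP; apply: contra_notT nocross => nz.
    by exists C1, C2, z1, z2, v.
  exists T, [::], (flatten [seq cycle_edges C | C <- cs] ++ Hd), W; split=> //.
    by split=> //; clear; lia.
  split=> //.
    move=> v; rewrite !cnt_cat; congr addn; last exact: bHd.
    elim: (cs) => //= C cs1 IHcs; rewrite !cnt_cat IHcs; congr addn.
    exact: cycle_edges_balanced.
  move=> e; rewrite mem_cat => /orP[|/lHd[/(subsetP sW) -> /(subsetP sW) ->] //].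
  by case/flatten_mapP=> C Ccs /mem_cycle_edges[/(hW _ _ Ccs) -> /(hW _ _ Ccs) ->].
have z1C2 : z1 \notin C2 by apply: contraNN nz => z1C2; rewrite (one C2 z1 z2).
have z2C1 : z2 \notin C1 by apply: contraNN nz => z2C1; rewrite (one C1 z1 z2).
have n12 : C2 != C1 by apply: contraNneq z2C1 => <-.
have /andP[_ uC1] := allP pcs C1 C1cs; have /andP[_ uC2] := allP pcs C2 C2cs.
have [s1 [s2 [H0 [pH [us1 us2] [sb1 sb2] bH0 lH0]]]] := recombine_cycles uC1 uC2 z1C1 z2C2 z1C2 z2C1 vC1 vC2.
pose B := [set z in C1 ++ C2].
have cB : #|[set u in B | (u \in Ap :|: Am) && (u \notin lev T 4)]| <= 2.
  apply: leq_trans (cardU_leq (un4 C1 C1cs) (un4 C2 C2cs)).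
  by apply/subset_leq_card/subsetP => u; rewrite !inE mem_cat andb_orl.
have lz z : z \notin lev T 5 -> leaver Ap Am R0 q T B z.
  by move=> zl; apply: (lev5_leaver resR dq q8 cB).
have sB s : {subset s <= C1 ++ C2} -> {subset s <= B} by move=> h x /h; rewrite inE.
have [T1 [F1 a1]] := absorb_leavers dis sT nz (lz _ z1l) (lz _ z2l) (sB _ sb1) (sB _ sb2) us1 us2.
have C2r : C2 \in rem C1 cs.
  have := perm_mem (perm_to_rem C1cs) C2; rewrite C2cs in_cons (negbTE n12) /=.
  by move=> <-.
have sz1 : size cs = (size (rem C1 cs)).+1 by rewrite (perm_size (perm_to_rem C1cs)).
have sz2 : size (rem C1 cs) = (size (rem C2 (rem C1 cs))).+1 by rewrite (perm_size (perm_to_rem C2r)).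
apply: (next _ T1 F1 (rem C2 (rem C1 cs)) H0 _ _ _ _ a1) => //.
- by move=> D /mem_rem/mem_rem.
- by rewrite -ltnS -sz2 -ltnS -sz1; apply: leqW.
- by rewrite sz1 sz2 ltnS leqnSn.
- have p1 := flat_rem _ _ C1cs; have p2 := flat_rem _ _ C2r.
  apply: perm_cnt => a; have := cnt_perm a p1; have := cnt_perm a p2; have := cnt_perm a pH.
  rewrite !cnt_cat; pose g (D : seq (seq V)) := cnt a (flatten [seq cycle_edges C | C <- D]).
  pose h D := cnt a (cycle_edges D); rewrite -!/(g _) -!/(h _).
  by move: (g cs) (g (rem C1 cs)) (g (rem C2 (rem C1 cs))) (h C1) (h C2); clear; lia.
(* The remainder avoids [z1] and [z2], the only vertices of the two cycles outside level 5. *)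
move=> e /lH0[]; rewrite !mem_cat !in_cons !in_nil !orbF !negb_or => e1 /andP[n1 n1'] e2 /andP[n2 n2'].
have key x : (x \in C1) || (x \in C2) -> x != z1 -> x != z2 -> x \in lev T 5.
  move=> xC nx1 nx2; apply: contraT => xl; case/orP: xC => xC.
    by rewrite (one C1 x z1) ?eqxx in nx1.
  by rewrite (one C2 x z2) ?eqxx in nx2.
by split; apply: key.
Qed.

End AbsorbCycles.

(** * Cycle partitions of balanced edge lists *)

Lemma uniq_flatten_disjoint (T : finType) (ss : seq (seq T)) :
  all uniq ss -> pairwise (fun s t : seq T => [disjoint s & t]) ss -> uniq (flatten ss).
Proof.
elim: ss => //= s ss IH /andP[us uss] /andP[ds dss]; rewrite cat_uniq us IH // andbT /=.
apply/hasPn => x /flattenP[t tss xt]; apply/negP => xs.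
by have := disjointFr (allP ds t tss) xs; rewrite xt.
Qed.

Lemma cycle_decomposition_edges (T : finType) (D : digraph T) F :
  cycle_decomposition D F ->
  [/\ proper_cycles F, uniq (flatten [seq cycle_edges C | C <- F]) &
    forall u v, ((u, v) \in flatten [seq cycle_edges C | C <- F]) = D u v].
Proof.
case=> aF [pF cF].
have pc : proper_cycles F by apply: sub_all aF => C /and3P[-> ->].
split=> //.
  apply: uniq_flatten_disjoint.
    by rewrite all_map; apply: sub_all pc => C /andP[_ uC]; apply: uniq_cycle_edges.
  by rewrite pairwise_map.
move=> u v; apply/flatten_mapP/idP => [[C CF]|/cF[C]]; last by exists C.
have /and3P[_ _] := allP aF C CF; case: C {CF} => // x s; rewrite cycle_edges_cons /= path_all_edges.
by move=> /allP h /h.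
Qed.

Lemma cycle_edges_map (S T : finType) (f : S -> T) s :
  cycle_edges (map f s) = [seq (f e.1, f e.2) | e <- cycle_edges s].
Proof.
rewrite /cycle_edges -map_rot; move: (rot 1 s) => t.
by elim: s t => [|x s IH] [|y t] //=; rewrite IH.
Qed.

Lemma cnt_uniq (V : finType) a (H : seq (V * V)) : uniq H -> cnt a H = #|[set e in H | a e]|.
Proof.
move=> uH; rewrite /cnt -size_filter -(card_uniqP (filter_uniq a uH)).
by apply: eq_card => e; rewrite mem_filter !inE andbC.
Qed.

(** The constant is applied to a digraph on the subtype of [W], so that the number of cycles is
    bounded in terms of [|W|] and shrinks from round to round. *)
Lemma eulerian_cycle_partition (R : realType) (c : R) (V : finType) (W : {set V}) (H : seq (V * V)) :
  cycle_decomposition_constant c -> uniq H -> balanced H ->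
  (forall e, e \in H -> e.1 != e.2) -> (forall e, e \in H -> e.1 \in W /\ e.2 \in W) ->
  exists cs, [/\ proper_cycles cs, perm_eq (flatten [seq cycle_edges C | C <- cs]) H &
    ((size cs)%:R <= c * #|W|%:R * ln #|W|%:R)%R].
Proof.
move=> hc uH bH lH hW.
pose S := {x : V | x \in W}.
pose r : rel S := fun x y => (val x, val y) \in H.
have ir : irreflexive r by move=> x; apply/negP => /lH; rewrite eqxx.
pose D := Digraph ir.
have eD : eulerian D.
  move=> v; transitivity (cnt (outof (val v)) H).
    rewrite /outdeg (cnt_uniq _ uH) -(card_imset (mem [set w | D v w]) (f := fun w => (val v, val w))); last first.
      by move=> x y [/val_inj].
    apply: eq_card => -[a b]; rewrite !inE; apply/imsetP/andP => [[w]|[abH /eqP av]].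
      by rewrite inE => vw [-> ->]; rewrite /outof eqxx.
    have [_ bW] := hW _ abH; exists (exist _ b bW); rewrite ?inE /= /r /= -?av //.
  rewrite /indeg bH (cnt_uniq _ uH) -(card_imset (mem [set w | D w v]) (f := fun w => (val w, val v))); last first.
    by move=> x y [/val_inj].
  apply: eq_card => -[a b]; rewrite !inE; apply/andP/imsetP => [[abH /eqP bv]|[w]].
    have [aW _] := hW _ abH; exists (exist _ a aW); rewrite ?inE /= /r /= -?bv //.
  by rewrite inE => vw [-> ->]; rewrite /into eqxx.
have [F dF szF] := hc _ _ eD.
have [pF uF mF] := cycle_decomposition_edges dF.
pose vv (e : S * S) := (val e.1, val e.2).
have vvI : injective vv by move=> [a b] [a' b'] [/val_inj -> /val_inj ->].
have eF : flatten [seq cycle_edges C | C <- map (map val) F] = map vv (flatten [seq cycle_edges C | C <- F]).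
  rewrite -map_comp map_flatten -[in RHS]map_comp; congr flatten; apply: eq_map => C /=.
  exact: cycle_edges_map.
exists (map (map val) F); split.
- rewrite /proper_cycles all_map; apply: sub_all pF => C /andP[sC uC] /=.
  by rewrite size_map sC map_inj_uniq //; apply: val_inj.
- rewrite eF; apply: uniq_perm => //; first by rewrite map_inj_uniq.
  move=> [a b]; apply/mapP/idP => [[[x y]]|abH].
    by rewrite mF => xy [-> ->].
  have [aW bW] := hW _ abH.
  by exists (exist _ a aW, exist _ b bW); rewrite ?mF.
by rewrite size_map; move: szF; rewrite card_sig.
Qed.

(** * Halving the remainder *)

Section Rounds.

Variables (V : finType) (Ap Am : {set V}) (q beta Delta M : nat).
Hypothesis dis : [disjoint Ap & Am].
Hypothesis q8 : 8 <= q.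
Hypothesis qV : 32 * #|V| <= q ^ 4.
Hypothesis qD : q + Delta <= beta * q.
Hypothesis qM : 32 * beta ^ 5 * M <= q.
Hypothesis cyc : forall (W : {set V}) (H : seq (V * V)), uniq H -> balanced H ->
  (forall e, e \in H -> e.1 != e.2) -> (forall e, e \in H -> e.1 \in W /\ e.2 \in W) ->
  exists cs, [/\ proper_cycles cs, perm_eq (flatten [seq cycle_edges C | C <- cs]) H &
    size cs <= M * #|W|].

Lemma reserveD d k (R T : {set V * V}) : reserve Ap Am (d + k) R -> (forall v, incid T v <= k) ->
  reserve Ap Am d (R :\: T).
Proof.
move=> [h1 h2] hT; split=> v nv.
  have sub : outn R v :&: Am \subset (outn (R :\: T) v :&: Am) :|: outn T v.
    apply/subsetP => w; rewrite !(in_setU, in_setI, mem_outn) in_setD => /andP[-> ->].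
    by case: (_ \in T).
  have := leq_trans (h1 v nv) (leq_trans (subset_leq_card sub) (leq_card_setU _ _)).
  by move: (hT v); rewrite /incid; clear; lia.
have sub : inn R v :&: Ap \subset (inn (R :\: T) v :&: Ap) :|: inn T v.
  apply/subsetP => w; rewrite !(in_setU, in_setI, mem_inn) in_setD => /andP[-> ->].
  by case: (_ \in T).
have := leq_trans (h2 v nv) (leq_trans (subset_leq_card sub) (leq_card_setU _ _)).
by move: (hT v); rewrite /incid; clear; lia.
Qed.

(** Each round leaves a balanced remainder on at most half as many vertices, so after [j] rounds no
    vertex is left. A round uses fewer than [q + 8] reserved edges at a vertex, which the term
    [j * (q + 8)] pays for; [4 * q] edges must be there in every round. *)
Lemma absorb_balanced j (W : {set V}) (R : {set V * V}) (H : seq (V * V)) :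
  #|W| < 2 ^ j -> reserve Ap Am (4 * q + j * (q + 8)) R -> (forall v, incid R v <= Delta) ->
  uniq (enum R ++ H) -> (forall e, e \in enum R ++ H -> e.1 != e.2) ->
  balanced H -> (forall e, e \in H -> e.1 \in W /\ e.2 \in W) ->
  exists F (R' : {set V * V}), [/\ R' \subset R, all (goodpath Ap Am) F &
    perm_eq (pedges F ++ enum R') (enum R ++ H)].
Proof.
elim: j W R H => [|j IH] W R H cW resR hD uRH lRH bH hW.
  have H0 : H = [::].
    case: H hW {uRH lRH bH} => // e H /(_ e (mem_head _ _))[eW _].
    by move: cW; rewrite (cardsD1 e.1) eW.
  by exists [::], R; split=> //; rewrite H0 cats0.
have uH : uniq H by move: uRH; rewrite cat_uniq => /and3P[].
have lH e : e \in H -> e.1 != e.2 by move=> eH; apply: lRH; rewrite mem_cat eH orbT.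
have [cs [pcs pC szcs]] := cyc uH bH lH hW.
have inc0 v : incid (set0 : {set V * V}) v = 0.
  have := card_outn_leq (set0 : {set V * V}) v; have := card_inn_leq (set0 : {set V * V}) v.
  by rewrite cards0 /incid; clear; lia.
have dq : 4 * q <= 4 * q + j.+1 * (q + 8) by apply: leq_addr.
have [|||T [F [H' [W' [[_ sT cT] hT [bH' hW' cW'] gF pF]]]]] :=
  absorb_cycles (Hd := [::]) dis resR dq q8 qV (sub0set R) pcs.
- by [].
- by [].
- by move=> v; rewrite inc0; clear; lia.
have pRH : perm_eq (pedges F ++ enum (R :\: T) ++ H') (enum R ++ H).
  by rewrite (perm_trans pF) // setD0 cats0 perm_cat2l.
(* [|W'| <= 2 |lev T 5| <= 2 beta^5 |spent|] and [q |spent| <= 2 |T| <= 8 |cs| <= 8 M |W|], so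
   [q |W'| <= 16 beta^5 M |W| <= q |W| / 2]. *)
have hw : #|W'| < 2 ^ j.
  have q0 : 0 < q by apply: leq_trans q8.
  have c1 := card_lev T 5 q0 hD qD; have c2 := card_spent q T.
  move: cT; rewrite cards0 add0n => cT.
  have : q * (2 * #|W'|) <= q * #|W|.
    have e1 := leq_mul (leqnn q) (leq_trans cW' (leq_mul (leqnn 2) c1)).
    have e2 := leq_mul (leqnn (beta ^ 5)) (leq_trans c2 (leq_mul (leqnn 2) (leq_trans cT (leq_mul (leqnn 4) szcs)))).
    have e3 := leq_mul qM (leqnn #|W|).
    move: e1 e2 e3; move: (beta ^ 5) #|W| #|W'| #|spent q T| => b w w' s; clear; lia.
  by rewrite leq_pmul2l // => /leq_ltn_trans/(_ cW); rewrite expnS ltn_pmul2l.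
have uRH' : uniq (enum (R :\: T) ++ H').
  by move: uRH; rewrite -(perm_uniq pRH) cat_uniq => /and3P[].
have lRH' e : e \in enum (R :\: T) ++ H' -> e.1 != e.2.
  by move=> eH; apply: lRH; rewrite -(perm_mem pRH) mem_cat eH orbT.
have resR' : reserve Ap Am (4 * q + j * (q + 8)) (R :\: T).
  apply: (@reserveD _ (q + 8)); first by rewrite -addnA [_ + (q + 8)]addnC -mulSn.
  by move=> v; apply: ltnW.
have hD' v : incid (R :\: T) v <= Delta.
  apply: leq_trans (hD v); apply: leq_add; apply: subset_leq_card.
    by apply: outnS; apply: subsetDl.
  by apply: innS; apply: subsetDl.
have [F2 [R' [sR' gF2 pF2]]] := IH W' (R :\: T) H' hw resR' hD' uRH' lRH' bH' hW'.
exists (F ++ F2), R'; split.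
- exact: subset_trans sR' (subsetDl _ _).
- by rewrite all_cat gF.
apply: perm_trans pRH; rewrite pedges_cat -catA perm_cat2l //.
Qed.

End Rounds.

(** * Assembling the decomposition *)

Section Assembly.

Variable V : finType.
Implicit Types (v u w : V) (F : seq (seq V)) (R : {set V * V}) (P N : {set V}).

Lemma cnt_outn R v : cnt (outof v) (enum R) = #|outn R v|.
Proof.
rewrite (cnt_uniq _ (enum_uniq _)) -(card_imset (mem (outn R v)) (f := fun w => (v, w))); last by move=> ? ? [].
apply: eq_card => -[a b]; rewrite inE mem_enum; apply/andP/imsetP => [[abR /eqP /= av]|[w]].
  by exists b; rewrite ?inE -?av.
by rewrite inE => vw [-> ->]; rewrite /outof eqxx.
Qed.

Lemma cnt_inn R v : cnt (into v) (enum R) = #|inn R v|.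
Proof.
rewrite (cnt_uniq _ (enum_uniq _)) -(card_imset (mem (inn R v)) (f := fun u => (u, v))); last by move=> ? ? [].
apply: eq_card => -[a b]; rewrite inE mem_enum; apply/andP/imsetP => [[abR /eqP /= bv]|[w]].
  by exists a; rewrite ?inE -?bv.
by rewrite inE => vw [-> ->]; rewrite /into eqxx.
Qed.

Definition starts F v := count (fun s => if s is x :: _ then x == v else false) F.
Definition ends F v := count (fun s => if s is x :: p then last x p == v else false) F.

Lemma starts0 P N F v : all (goodpath P N) F -> v \notin P -> starts F v = 0.
Proof.
move=> gF vP; apply/eqP; rewrite -leqn0 leqNgt -has_count; apply/negP => /hasP[s /(allP gF)].
by case: s => //= x p /and4P[_ _ xP _] /eqP xv; rewrite -xv xP in vP.
Qed.

Lemma ends0 P N F v : all (goodpath P N) F -> v \notin N -> ends F v = 0.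
Proof.
move=> gF vN; apply/eqP; rewrite -leqn0 leqNgt -has_count; apply/negP => /hasP[s /(allP gF)].
by case: s => //= x p /and4P[_ _ _ xN] /eqP xv; rewrite -xv xN in vN.
Qed.

Lemma pedges_flow P N F v : all (goodpath P N) F ->
  cnt (outof v) (pedges F) + ends F v = cnt (into v) (pedges F) + starts F v.
Proof.
elim: F => // -[|x p] F IH // /andP[_ /IH]; have := path_edges_flow v x p.
by rewrite /pedges /ends /starts /= !cnt_cat; clear; lia.
Qed.

Lemma sum_starts P N F : all (goodpath P N) F -> \sum_v starts F v = size F.
Proof.
elim: F => [|[|x p] F IH] //=; first by rewrite big1.
case/andP=> _ /IH <-; rewrite /starts /= big_split /= -[in RHS]add1n; congr addn.
by rewrite (bigD1 x) //= eqxx big1 // => v; rewrite eq_sym => /negbTE->.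
Qed.

Lemma sum_ends P N F : all (goodpath P N) F -> \sum_v ends F v = size F.
Proof.
elim: F => [|[|x p] F IH] //=; first by rewrite big1.
case/andP=> _ /IH <-; rewrite /ends /= big_split /= -[in RHS]add1n; congr addn.
by rewrite (bigD1 (last x p)) //= eqxx big1 // => v; rewrite eq_sym => /negbTE->.
Qed.

Variable D : digraph V.

Definition edge_set := [set e | D e.1 e.2].
Definition surplus := [set v | (0 < excess_at D v)%R].
Definition deficit := [set v | (excess_at D v < 0)%R].

Lemma outn_edge_set v : #|outn edge_set v| = outdeg D v.
Proof. by apply: eq_card => w; rewrite mem_outn !inE. Qed.

Lemma inn_edge_set v : #|inn edge_set v| = indeg D v.
Proof. by apply: eq_card => w; rewrite mem_inn !inE. Qed.

(** The excess at a vertex is the number of paths starting there minus the number ending there. No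
    vertex is both a start and an end, so its absolute value is the sum of the two, and the total
    over all vertices counts every path twice. *)
Lemma goodpaths_perfect F : all (goodpath surplus deficit) F ->
  perm_eq (pedges F) (enum edge_set) -> perfect_decomposition D F.
Proof.
move=> gF pF; have uF : uniq (pedges F) by rewrite (perm_uniq pF) enum_uniq.
have mF u v : ((u, v) \in pedges F) = D u v by rewrite (perm_mem pF) mem_enum inE.
split.
- apply/allP => s sF; have := allP gF s sF; case: s sF => [|x p] // sF /and4P[pn up _ _].
  rewrite /is_path up; apply/and3P; split=> //; first by case: (p) pn.
  rewrite /= path_all_edges; apply/allP => -[a b] ab; rewrite -mF.
  by apply/flatten_mapP; exists (x :: p).
- split; last by move=> u v; rewrite -mF => /flatten_mapP[s]; exists s.
  elim: (F) uF => //= s F' IH; rewrite /pedges /= cat_uniq => /and3P[_ h /IH ->].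
  rewrite andbT; apply/allP => t tF; rewrite disjoint_sym disjoint_has.
  apply: contra h => /hasP[e et es]; apply/hasP; exists e => //.
  by apply/flatten_mapP; exists t.
have exE v : excess_at D v = ((starts F v)%:Z - (ends F v)%:Z)%R.
  have := pedges_flow v gF; rewrite (cnt_perm _ pF) (cnt_perm (into v) pF) cnt_outn cnt_inn.
  by rewrite outn_edge_set inn_edge_set /excess_at; clear; lia.
have absE v : `|excess_at D v|%N = starts F v + ends F v.
  have [vp|vp] := boolP (v \in surplus).
    rewrite exE (ends0 gF) ?addn0 ?GRing.subr0 //; move: vp; rewrite !inE; clear; lia.
  by rewrite exE (starts0 gF vp) GRing.sub0r; clear; lia.
rewrite /excess.
have -> : (\sum_v `|excess_at D v|%:~R = ((\sum_v (starts F v + ends F v))%:R : rat))%R.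
  by rewrite GRing.natr_sum; apply: eq_bigr => v _; rewrite -absE natr_absz.
rewrite big_split /= (sum_starts gF) (sum_ends gF) addnn -muln2 GRing.natrM GRing.mulrC.
by rewrite -GRing.mulrA GRing.mulfV ?GRing.mulr1.
Qed.

End Assembly.

Lemma perfect_decomposition_of_reservoir (V : finType) (D : digraph V) (Ap Am : {set V})
    (q beta Delta M J : nat) (R : {set V * V}) :
  [disjoint Ap & Am] -> 8 <= q -> 32 * #|V| <= q ^ 4 -> q + Delta <= beta * q ->
  32 * beta ^ 5 * M <= q ->
  (forall (W : {set V}) (H : seq (V * V)), uniq H -> balanced H ->
    (forall e, e \in H -> e.1 != e.2) -> (forall e, e \in H -> e.1 \in W /\ e.2 \in W) ->
    exists cs, [/\ proper_cycles cs, perm_eq (flatten [seq cycle_edges C | C <- cs]) H &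
      size cs <= M * #|W|]) ->
  #|V| < 2 ^ J ->
  R \subset edge_set D -> forward Ap Am R -> reserve Ap Am (4 * q + J * (q + 8)) R ->
  (forall v, v \notin Ap -> v \notin Am -> #|outn R v| = #|inn R v|) ->
  (forall v, incid R v <= Delta) ->
  (forall v, v \in Ap -> (0 < excess_at D v)%R) ->
  (forall v, v \in Am -> (excess_at D v <= - Delta%:Z)%R /\ (excess_at D v < 0)%R) ->
  (forall v, v \in Ap -> (Delta%:Z <= excess_at D v)%R) ->
  exists F, perfect_decomposition D F.
Proof.
move=> dis q8 qV qD qM cyc cV sR fR resR balR hD exP exM exP'.
have nAp v : v \in Am -> v \notin Ap by move=> vm; apply/negP => /(disjointFr dis); rewrite vm.
have sP : Ap \subset surplus D by apply/subsetP => v /exP; rewrite inE.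
have sM : Am \subset deficit D by apply/subsetP => v /exM[_]; rewrite inE.
have out0 v : v \in Am -> #|outn R v| = 0.
  move=> vm; apply/eqP; rewrite cards_eq0; apply/eqP/setP => w; rewrite mem_outn in_set0.
  by apply/negP => /fR[]; rewrite vm.
have in0 v : v \in Ap -> #|inn R v| = 0.
  move=> vp; apply/eqP; rewrite cards_eq0; apply/eqP/setP => w; rewrite mem_inn in_set0.
  by apply/negP => /fR[]; rewrite vp.
pose L := enum (edge_set D :\: R).
have split_edges : perm_eq (enum (edge_set D)) (enum R ++ L).
  have := @enum_setD_perm _ (edge_set D) (enum R) (enum_uniq _).
  rewrite (_ : [set e in enum R] = R); last by apply/setP => e; rewrite inE mem_enum.
  by apply=> e; rewrite mem_enum => /(subsetP sR).
have exL v : excess_at D v = ((cnt (outof v) L)%:Z - (cnt (into v) L)%:Z + ((#|outn R v|)%:Z - (#|inn R v|)%:Z))%R.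
  have := cnt_perm (outof v) split_edges; have := cnt_perm (into v) split_edges.
  rewrite !cnt_cat !cnt_outn !cnt_inn outn_edge_set inn_edge_set /excess_at.
  by clear; lia.
have [F1 [H [pF1 bH gF1]]] := path_peeling L.
(* On A0 the reservoir is balanced, so [L] has the excess of [D]. On A+ and A- it takes at most
   [Delta] edges, too few to reverse the sign of the excess. *)
have {}gF1 : all (goodpath (surplus D) (deficit D)) F1.
  apply: sub_all gF1 => s; apply: goodpath_sub; apply/subsetP => v; rewrite !inE => hv.
    have [vp|np] := boolP (v \in Ap); first exact: exP.
    have [vm|nm] := boolP (v \in Am).
      have [e1 _] := exM v vm; move: hv e1 (hD v); rewrite exL (out0 v vm) /incid; clear; lia.
    by move: hv; rewrite exL balR //; clear; lia.
  have [vm|nm] := boolP (v \in Am); first by have [] := exM v vm.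
  have [vp|np] := boolP (v \in Ap).
    have e1 := exP' v vp; move: hv e1 (hD v); rewrite exL (in0 v vp) /incid; clear; lia.
  by move: hv; rewrite exL balR //; clear; lia.
have pall : perm_eq (enum (edge_set D)) (pedges F1 ++ (enum R ++ H)).
  apply: perm_trans split_edges _; apply: perm_cnt => a; have := cnt_perm a pF1.
  by rewrite !cnt_cat; clear; lia.
have uRH : uniq (enum R ++ H).
  by move: (enum_uniq (edge_set D)); rewrite (perm_uniq pall) cat_uniq => /and3P[].
have lRH e : e \in enum R ++ H -> e.1 != e.2.
  move=> eRH; have : e \in enum (edge_set D) by rewrite (perm_mem pall) mem_cat eRH orbT.
  by rewrite mem_enum inE; apply: contraTneq => ->; rewrite edge_irr.
have cVT : #|[set: V]| < 2 ^ J by rewrite cardsT.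
have [|F2 [R' [sR' gF2 pF2]]] := absorb_balanced dis q8 qV qD qM cyc cVT resR hD uRH lRH bH.
  by move=> e _; rewrite !inE.
have [F3 [H3 [pF3 bH3 gF3]]] := path_peeling (enum R').
have H3R e : e \in H3 -> e \in R.
  by move=> eH; apply: (subsetP sR'); rewrite -mem_enum (perm_mem pF3) mem_cat eH orbT.
(* By balance, an edge out of A+ would require one into A+, and an edge into A- one out of A-.
   Forward edges provide neither, yet each is of one of these kinds. *)
have H30 : H3 = [::].
  have outM e : e \in H3 -> e.2 \in Am -> False.
    move=> eH em; have : 0 < cnt (into e.2) H3.
      by rewrite -has_count; apply/hasP; exists e; rewrite // /into eqxx.
    rewrite -bH3 -has_count => /hasP[[u w] /H3R/fR[nu _ _]] /eqP /= uw.
    by rewrite -uw (negbTE nu) in em.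
  have inP e : e \in H3 -> e.1 \in Ap -> False.
    move=> eH em; have : 0 < cnt (outof e.1) H3.
      by rewrite -has_count; apply/hasP; exists e; rewrite // /outof eqxx.
    rewrite bH3 -has_count => /hasP[[u w] /H3R/fR[_ nw _]] /eqP /= uw.
    by rewrite -uw (negbTE nw) in em.
  case: (H3) H3R outM inP => // -[u w] r sub outM inP; exfalso.
  have uwH := mem_head (u, w) r; have /fR[_ _ /orP[up|wm]] := sub _ uwH.
    exact: inP uwH up.
  exact: outM uwH wm.
(* [R] and [H] are balanced at [v], and no path of [F2] starts or ends there. *)
have bal' v : v \notin Ap -> v \notin Am -> #|outn R' v| = #|inn R' v|.
  move=> np nm; have := pedges_flow v gF2; rewrite (starts0 gF2 np) (ends0 gF2 nm).
  have := cnt_perm (outof v) pF2; have := cnt_perm (into v) pF2; have := bH v.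
  by rewrite !cnt_cat !cnt_outn !cnt_inn balR //; clear; lia.
have {}gF3 : all (goodpath (surplus D) (deficit D)) F3.
  apply: sub_all gF3 => s; apply: goodpath_sub; apply/subsetP => v; rewrite !inE !cnt_outn !cnt_inn => hv.
    have [vp|np] := boolP (v \in Ap); first exact: exP.
    have [vm|nm] := boolP (v \in Am).
      have := subset_leq_card (outnS v sR'); rewrite (out0 v vm); move: hv; clear; lia.
    by move: hv; rewrite bal' // ltnn.
  have [vm|nm] := boolP (v \in Am); first by have [] := exM v vm.
  have [vp|np] := boolP (v \in Ap).
    have := subset_leq_card (innS v sR'); rewrite (in0 v vp); move: hv; clear; lia.
  by move: hv; rewrite bal' // ltnn.
exists (F1 ++ F2 ++ F3); apply: goodpaths_perfect.
  rewrite !all_cat gF1 gF3 andbT /=; apply: sub_all gF2 => s; exact: goodpath_sub.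
apply: perm_cnt => a; have := cnt_perm a pall; have := cnt_perm a pF2; have := cnt_perm a pF3.
by rewrite H30 cats0 !pedges_cat !cnt_cat; clear; lia.
Qed.

Lemma perfect_decomposition_criterion (V : finType) (D : digraph V) (Ap Am : {set V})
    (q M J delta delta' : nat) :
  let d := 4 * q + J * (q + 8) in
  [disjoint Ap & Am] -> 8 <= q -> 32 * #|V| <= q ^ 4 ->
  32 * (301 * J ^ 2) ^ 5 * M <= q ->
  (forall (W : {set V}) (H : seq (V * V)), uniq H -> balanced H ->
    (forall e, e \in H -> e.1 != e.2) -> (forall e, e \in H -> e.1 \in W /\ e.2 \in W) ->
    exists cs, [/\ proper_cycles cs, perm_eq (flatten [seq cycle_edges C | C <- cs]) H &
      size cs <= M * #|W|]) ->
  0 < J -> #|V| < 2 ^ J -> 2 * d <= delta -> 2 * d <= delta' ->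
  (forall v, v \in Ap -> delta <= edges_to D v Am <= 4 * delta) ->
  (forall v, v \in Am -> delta <= edges_from D Ap v <= 4 * delta) ->
  (forall v, v \in Ap -> edges_to D v (~: (Ap :|: Am)) <= 4 * delta') ->
  (forall v, v \in Am -> edges_from D (~: (Ap :|: Am)) v <= 4 * delta') ->
  (forall v, v \notin Ap :|: Am -> delta' <= edges_from D Ap v /\ delta' <= edges_to D v Am) ->
  (forall v, v \in Ap -> ((33 * d * J)%:Z <= excess_at D v)%R) ->
  (forall v, v \in Am -> (excess_at D v <= - (33 * d * J)%:Z)%R) ->
  exists F, perfect_decomposition D F.
Proof.
move=> d dis q8 qV qM cyc J0 cV dd dd' h1 h2 h3 h4 h5 exP exM.
have [||||||R [RG fR resR balR hD]] := reservoir_exists (G := D) dis J0 cV dd dd'.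
- exact: h1.
- exact: h2.
- exact: h3.
- exact: h4.
- by move=> v /h5[].
- by move=> v /h5[].
have d0 : 0 < 33 * d * J by rewrite /d; move: q8 J0; clear; nia.
(* From [d <= 9 J q] follows [33 d J <= 297 J^2 q]; the factor 301 leaves room for the summand
   [q]. *)
have qD : q + 33 * d * J <= 301 * J ^ 2 * q.
  rewrite -mulnn /d.
  have a1 : 8 * J <= q * J by rewrite leq_mul2r q8 orbT.
  have a2 : q <= J * q by rewrite leq_pmull.
  have a3 : J * (4 * q + J * (q + 8)) <= J * (9 * (J * q)).
    by rewrite leq_mul2l; move: a1 a2; clear; lia.
  by move: a2 a3; have : J * q <= J * (J * q) by [rewrite leq_pmull]; clear; lia.
apply: (@perfect_decomposition_of_reservoir V D Ap Am q (301 * J ^ 2) (33 * d * J) M J R) => //.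
- by apply/subsetP => -[u w] /RG; rewrite inE.
- by move=> v /exP; move: d0; move: (33 * d * J) => k; clear; lia.
by move=> v /exM; move: d0; move: (33 * d * J) => k; clear; lia.
Qed.

(** * Parameters *)

(** With [m = 2 k], [J <= m 2^(J/m)] gives [J^k <= m^k 2^(J/2)], and the other half of the exponent
    beats the constant [C m^k]. *)
Lemma expn2_dominates C k : exists J0, forall J, J0 <= J -> C * J ^ k <= 2 ^ J.
Proof.
have [->|k0] := posnP k.
  by exists C => J CJ; rewrite expn0 muln1; apply: leq_trans CJ (ltnW (ltn_expl _ _)).
pose m := 2 * k; pose A := C * m ^ k.
exists (2 * A) => J hJ.
have m0 : 0 < m by rewrite muln_gt0.
have hm : J <= m * 2 ^ (J %/ m).
  rewrite {1}(divn_eq J m) mulnC; apply: (@leq_trans (m * (J %/ m).+1)).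
    by rewrite mulnS addnC leq_add2r ltnW ?ltn_pmod.
  by rewrite leq_mul2l ltn_expl ?orbT.
have h1 : J ^ k <= m ^ k * 2 ^ (J %/ m * k).
  by rewrite expnM -expnMn leq_exp2r.
have h2 : J %/ m * k <= J %/ 2.
  by rewrite leq_divRL // -mulnA [k * 2]mulnC leq_trunc_div.
have h3 : A <= 2 ^ (J - J %/ 2).
  apply: leq_trans (ltnW (ltn_expl A (ltnSn 1))) _; rewrite leq_exp2l //.
  by move: hJ (leq_trunc_div J 2); clear; lia.
have h4 : 2 ^ J = 2 ^ (J - J %/ 2) * 2 ^ (J %/ 2) by rewrite -expnD subnK // leq_div.
rewrite h4; apply: (@leq_trans (A * 2 ^ (J %/ m * k))).
  by rewrite -mulnA leq_mul2l h1 orbT.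
by apply: leq_mul => //; rewrite leq_exp2l.
Qed.

(** The exponent 20 lets [r ^ 5] stand for [n^(1/4)], the order of [q], and [r ^ 6] for [n^(3/10)],
    a lower bound for [kappa] and [n p]; the factor [r] between them swallows all powers of log n.
    If [r < K J^11], then [n < K^20 J^220], while [2^J <= 2 n]. *)
Lemma root20_dominates K : exists n0, forall n, n0 <= n ->
  exists r, [/\ r ^ 20 <= n, n < r.+1 ^ 20 & K * (trunc_log 2 n).+1 ^ 11 <= r].
Proof.
have [J0 hJ0] := expn2_dominates (2 * K ^ 20) (11 * 20).
exists (2 ^ J0) => n hn.
have n0 : 0 < n by apply: leq_trans hn; rewrite expn_gt0.
have ex0 : exists r, r ^ 20 <= n by exists 0; rewrite exp0n.
have bd r : r ^ 20 <= n -> r <= n.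
  by case: r => // r; apply: leq_trans; rewrite -{1}[r.+1]expn1 leq_pexp2l.
case: (ex_maxnP ex0 bd) => r hr maxr; exists r.
have ltr : n < r.+1 ^ 20.
  by rewrite ltnNge; apply/negP => /maxr; rewrite ltnn.
split=> //; rewrite leqNgt; apply/negP => lt.
set J := (trunc_log 2 n).+1 in lt *.
have J0J : J0 <= J by apply: leqW; apply: trunc_log_max.
have h1 : n < K ^ 20 * J ^ (11 * 20).
  by apply: leq_trans ltr _; rewrite expnM -expnMn leq_exp2r.
have h2 : 2 ^ J <= 2 * n by rewrite expnS leq_mul2l trunc_logP.
by have := leq_trans h2 (ltnW _); move: (hJ0 J J0J); rewrite -mulnA; move: h1 h2;
  move: (K ^ 20 * J ^ (11 * 20)) (2 ^ J); clear; lia.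
Qed.

Import Order.TTheory GRing.Theory Num.Theory.
Local Open Scope ring_scope.

Lemma nat_ceil (R : realType) (x : R) :
  exists d : nat, x <= d%:R /\ forall k : nat, x <= k%:R -> (d <= k)%N.
Proof.
have ex : exists d : nat, x <= d%:R.
  exists (Num.bound `|x|); apply: le_trans (ler_norm x) (ltW (archi_boundP _)).
  exact: normr_ge0.
by case: (ex_minnP ex) => d hd mind; exists d.
Qed.

Lemma ln_nat_le (R : realType) (n J : nat) : (n < 2 ^ J)%N -> ln (n%:R : R) <= J%:R.
Proof.
move=> nJ; have [->|n0] := posnP n; first by rewrite ln0.
rewrite -ler_expR lnK ?posrE ?ltr0n //.
apply: (@le_trans _ _ ((2 ^ J)%N%:R)); first by rewrite ler_nat ltnW.
rewrite natrX -[J%:R]mulr1 expRM_natl.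
apply: lerXn2r; rewrite ?nnegrE ?expR_ge0 //.
by have := expR_ge1Dx (1 : R); rewrite -natr1.
Qed.

Lemma powR_mono (R : realType) (x y a : R) : 0 <= a -> 0 <= x -> x <= y -> x `^ a <= y `^ a.
Proof.
move=> a0 x0 xy; apply: (ge0_ler_powR a0); rewrite ?nnegrE //.
exact: le_trans xy.
Qed.

Lemma natpow_le_powR (R : realType) (n r k : nat) : (r ^ 20 <= n)%N ->
  r%:R ^+ k <= (n%:R : R) `^ (k%:R / 20).
Proof.
move=> rn; apply: (@le_trans _ _ ((r%:R ^+ 20) `^ (k%:R / 20))).
  by rewrite -powR_mulrn ?ler0n // -powRrM mulrCA mulfV ?mulr1 ?powR_mulrn ?ler0n ?pnatr_eq0 //.
apply: powR_mono; rewrite ?exprn_ge0 ?ler0n ?divr_ge0 ?ler0n //.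
by rewrite -natrX ler_nat.
Qed.

(* The hypotheses (C1)-(C3) and (C'1)-(C'3) enter only through these polynomial
   lower bounds on [kappa] and [n p], with [r] the integral 20th root of [n]. *)
Lemma perfect_decomposition_large (R : realType) (c' : R) (V : finType) (D : digraph V)
    (m r J : nat) (p kappa lambda : R) :
  cycle_decomposition_constant c' -> 0 <= c' -> c' <= m%:R -> (0 < J)%N ->
  (#|V| < 2 ^ J)%N -> (#|V| < r.+1 ^ 20)%N ->
  ((301 ^ 5 * m + 100 * 100) * J ^ 11 <= r)%N ->
  r%:R ^+ 6 <= kappa -> r%:R ^+ 6 <= #|V|%:R * p -> lambda <= #|V|%:R * p / 3 ->
  npkl_digraph #|V| p kappa lambda D ->
  exists F, perfect_decomposition D F.
Proof.
move=> hc c0 cm J0 VJ Vr hr kr pr lp [_ _ _ _ [Ap [Am [A0 [[_ _ [dis dis1 dis2] cov] h1 h2 h3 h4]]]]].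
have eA0 : A0 = ~: (Ap :|: Am).
  apply/setP => v; have := in_setT v; rewrite -cov !inE.
  have [vp|_] := boolP (v \in Ap); first by rewrite (disjointFr dis1 vp).
  by have [vm|_] := boolP (v \in Am); first by rewrite (disjointFr dis2 vm).
(* Rounding up gives [n p <= 4 delta] and [lambda <= n p / 3 <= delta']; minimality turns the lower
   degree bounds into integral ones. *)
have [delta [hd mind]] := nat_ceil (#|V|%:R * p / 4).
have [delta' [hd' mind']] := nat_ceil (#|V|%:R * p / 3).
(* [n < (r + 1)^20 <= 2^20 r^20], and [32 * 2^20 <= 2^28 = (2^7)^4]. *)
pose q := (2 ^ 7 * r ^ 5)%N.
have J11 k : (k <= 11 -> 100 * 100 * J ^ k <= r)%N.
  move=> hk; apply: leq_trans hr; apply: leq_mul; first exact: leq_addl.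
  by rewrite leq_pexp2l.
have r0 : (0 < r)%N by apply: leq_trans (J11 0%N isT); rewrite muln_gt0.
have q8 : (8 <= q)%N by rewrite /q; have : (0 < r ^ 5)%N; [rewrite expn_gt0 r0 | clear; lia].
have qV : (32 * #|V| <= q ^ 4)%N.
  have e : (q ^ 4 = 2 ^ 8 * (2 ^ 20 * r ^ 20))%N.
    by rewrite /q expnMn -!expnM mulnA -expnD.
  have : (r.+1 ^ 20 <= 2 ^ 20 * r ^ 20)%N by rewrite -expnMn leq_exp2r // mul2n -addnn -addn1 leq_add2l.
  rewrite e => /(leq_trans (ltnW Vr)); move: (2 ^ 20 * r ^ 20)%N => k h.
  by apply: leq_mul.
(* Here [M = m J] because [c' * ln n <= m J]; with [J^10] from [beta ^ 5] this makes [J^11]. *)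
have qM : (32 * (301 * J ^ 2) ^ 5 * (m * J) <= q)%N.
  rewrite expnMn -expnM -[(2 * 5)%N]/10%N.
  have h : (301 ^ 5 * m * J ^ 11 <= r)%N.
    by apply: leq_trans hr; rewrite leq_mul2r leq_addr orbT.
  have h5 : (r <= r ^ 5)%N by rewrite -{1}[r]expn1 leq_pexp2l.
  apply: (@leq_trans (32 * (301 ^ 5 * m * J ^ 11))).
    rewrite [(J ^ 11)%N]expnSr; move: (301 ^ 5)%N (J ^ 10)%N => a b; clear; lia.
  by move: h h5; rewrite /q; move: (301 ^ 5 * m * J ^ 11)%N (r ^ 5)%N => a b; clear; lia.
pose d := (4 * q + J * (q + 8))%N.
have dle : (d <= 1152 * (J * r ^ 5))%N.
  have a1 : (8 * J <= q * J)%N by rewrite leq_mul2r q8 orbT.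
  have a2 : (q <= J * q)%N by rewrite leq_pmull.
  by rewrite /d; move: a1 a2; rewrite /q; move: (r ^ 5)%N => k; clear; lia.
(* The constant [100 * 100] is chosen for this: [2 d <= 2304 J r^5] has to stay below [r^6 / 4]. *)
have r6 : (100 * 100 * (J * r ^ 5) <= r ^ 6)%N.
  by rewrite mulnA [(r ^ 6)%N]expnS leq_mul2r -{1}[J]expn1 J11 ?orbT.
have r6' : (100 * 100 * (J ^ 2 * r ^ 5) <= r ^ 6)%N.
  by rewrite mulnA [(r ^ 6)%N]expnS leq_mul2r J11 ?orbT.
have dd : (2 * d <= delta)%N.
  have: (r ^ 6 <= 4 * delta)%N.
    rewrite -(ler_nat R) natrX natrM; apply: le_trans pr _.
    by move: hd; rewrite ler_pdivrMr ?ltr0n // [X in _ <= X]mulrC.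
  by move: dle r6; move: (J * r ^ 5)%N (r ^ 6)%N => a b; clear; lia.
have dd' : (2 * d <= delta')%N.
  have: (r ^ 6 <= 3 * delta')%N.
    rewrite -(ler_nat R) natrX natrM; apply: le_trans pr _.
    by move: hd'; rewrite ler_pdivrMr ?ltr0n // [X in _ <= X]mulrC.
  by move: dle r6; move: (J * r ^ 5)%N (r ^ 6)%N => a b; clear; lia.
have exk : ((33 * d * J)%N%:R : R) <= 155 * kappa.
  apply: (@le_trans _ _ (155 * (r ^ 6)%N%:R)); last by rewrite ler_pM2l ?ltr0n // natrX.
  rewrite -natrM ler_nat; have := leq_mul dle (leqnn J).
  have -> : (1152 * (J * r ^ 5) * J = 1152 * (J ^ 2 * r ^ 5))%N.
    by rewrite -mulnn; move: (r ^ 5)%N => k; clear; lia.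
  by move: r6'; move: (J ^ 2 * r ^ 5)%N (r ^ 6)%N => a b; clear; nia.
have up4 (e : nat) : (e%:R : R) <= #|V|%:R * p -> (e <= 4 * delta)%N.
  rewrite -(ler_nat R) natrM => h; apply: le_trans h _.
  by move: hd; rewrite ler_pdivrMr ?ltr0n // [X in _ <= X]mulrC.
have upl (e : nat) : (e%:R : R) <= lambda -> (e <= 4 * delta')%N.
  move=> h; apply: (@leq_trans delta'); last by rewrite leq_pmull.
  by rewrite -(ler_nat R); apply: le_trans h (le_trans lp hd').
apply: (@perfect_decomposition_criterion V D Ap Am q (m * J) J delta delta') => //.
- move=> W H uH bH lH hW; have [cs [pcs pC szcs]] := eulerian_cycle_partition hc uH bH lH hW.
  exists cs; split=> //; rewrite -(ler_nat R); apply: le_trans szcs _.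
  rewrite mulrAC !natrM; apply: ler_wpM2r; rewrite ?ler0n //.
  have lJ : ln (#|W|%:R : R) <= J%:R.
    by apply: ln_nat_le; apply: leq_ltn_trans VJ; apply: max_card.
  apply: (@le_trans _ _ (c' * J%:R)); first by rewrite ler_wpM2l.
  by rewrite ler_wpM2r ?ler0n.
- by move=> v /h1[_ /andP[a b]]; rewrite mind ?up4.
- by move=> v /h2[_ /andP[a b]]; rewrite mind ?up4.
- move=> v vp; have [|a _] := h3 v; first by rewrite inE vp.
  by rewrite -eA0; apply: upl.
- move=> v vm; have [|_ a] := h3 v; first by rewrite inE vm orbT.
  by rewrite -eA0; apply: upl.
- move=> v vX; have [|a b] := h4 v; first by rewrite eA0 inE.
  by split; apply: mind'.
- move=> v /h1[a _]; rewrite -(ler_int R); exact: le_trans a.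
move=> v /h2[a _]; rewrite -(ler_int R) mulrNz; apply: le_trans a _.
by rewrite lerN2.
Qed.

(** The digraph with two vertices and both edges is Eulerian and needs at least one cycle. *)
Lemma cycle_decomposition_constant_gt0 (R : realType) (c' : R) :
  cycle_decomposition_constant c' -> 0 < c'.
Proof.
move=> hc; have ir : irreflexive (fun x y : bool => x != y) by move=> x; rewrite eqxx.
have [|F [_ [_ cov]] szF] := hc _ (Digraph ir).
  by move=> v; apply: eq_card => w; rewrite !inE; case: v w => -[].
have [|s sF _] := cov true false; first by [].
rewrite ltNge; apply/negP => c0; have : (0 < size F)%N by case: (F) sF.
rewrite -(ltr_nat R) ltNge => /negP; apply; apply: le_trans szF _.
by rewrite -mulrA mulr_le0_ge0 // mulr_ge0 ?ler0n // ln_ge0 // card_bool ler1n.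
Qed.

Theorem theorem4p3 (R : realType) (c' : R)
    (hc' : cycle_decomposition_constant c') :
  exists n0 : nat, forall (n : nat) (p kappa lambda : R),
    (n0 <= n)%N -> 0 < p < 1 ->
    let N := c' * n%:R * ln n%:R in
    lambda = Num.min (n%:R * p / 3) (kappa ^+ 2 / 12) ->
    (kappa = 3 * N `^ (2 / 5) -> 365 * N `^ (2 / 5) <= n%:R * p ->
     forall (V : finType) (D : digraph V), npkl_digraph n p kappa lambda D ->
     exists F : seq (seq V), perfect_decomposition D F)
    /\
    (kappa = 6 * (N ^+ 2 * p) `^ (1 / 5) ->
     n%:R `^ (- (1 / 3)) * ln n%:R ^+ 4 <= p ->
     forall (V : finType) (D : digraph V),
     npkl_pseudorandom n p kappa lambda D ->
     exists F : seq (seq V), perfect_decomposition D F).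
Proof.
(* All powers of [n] are compared with [n^(6/20)]: the exponents are 2/5 in the first case, and
   [(2 - 1/3) / 5] for [kappa] and [1 - 1/3] for [n p] in the second. *)
have e0 : 0 <= (2 / 5 : R) /\ 0 <= (1 / 5 : R) by split; lra.
have e1 : (6 / 20 : R) <= 2 / 5 by lra.
have e2 : (6 / 20 : R) = (3 / 2) * (1 / 5) by lra.
have e3 : (3 / 2 : R) <= 2 + - (1 / 3) by lra.
have e4 : (6 / 20 : R) <= 1 + - (1 / 3) by lra.
have c0 := cycle_decomposition_constant_gt0 hc'.
pose m := Num.bound c'.
have cm : c' <= m%:R by rewrite ltW // archi_boundP // ltW.
have [n1 hn1] := root20_dominates (301 ^ 5 * m + 100 * 100).
(* From [n >= exp (1 + 1/c')] follow [ln n >= 1] and [c' * ln n >= 1], hence [N >= n]. *)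
exists (maxn n1 (Num.bound (expR (1 + c'^-1)))) => n p kappa lambda.
rewrite geq_max => /andP[nn1 nn2] /andP[p0 p1] N hl.
have [r [rn nr hr]] := hn1 n nn1.
have n0 : (0 < n)%N by rewrite (leq_trans _ nn2) // -(ltr_nat R) (le_lt_trans _ (archi_boundP _)) ?expR_ge0.
have n1' : 1 <= (n%:R : R) by rewrite ler1n.
have lnn : 1 + c'^-1 <= ln (n%:R : R).
  rewrite -ler_expR lnK ?posrE ?ltr0n //; apply: le_trans (ltW (archi_boundP _)) _; rewrite ?expR_ge0 //.
  by rewrite ler_nat.
have ci0 : 0 < c'^-1 by rewrite invr_gt0.
have ln1 : 1 <= ln (n%:R : R) by apply: le_trans lnn; rewrite lerDl ltW.
have nN : (n%:R : R) <= N.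
  rewrite /N mulrAC -[X in X <= _]mul1r ler_wpM2r ?ler0n //.
  apply: (@le_trans _ _ (c' * (1 + c'^-1))); last by rewrite ler_pM2l.
  by rewrite mulrDr mulfV ?gt_eqF // mulr1 lerDr ltW.
have rk k := natpow_le_powR R k rn.
have r1 : (0 < r)%N.
  by apply: leq_trans hr; rewrite muln_gt0 addn_gt0 [X in X && _]orbC expn_gt0.
have lp : lambda <= n%:R * p / 3 by rewrite hl ge_min lexx.
have main (V : finType) (D : digraph V) : r%:R ^+ 6 <= kappa -> r%:R ^+ 6 <= n%:R * p ->
    npkl_digraph n p kappa lambda D -> exists F : seq (seq V), perfect_decomposition D F.
  move=> kr pr hD; case: (hD) => _ _ _ eV _; rewrite -eV in hr nr pr lp hD.
  have VJ : (#|V| < 2 ^ (trunc_log 2 #|V|).+1)%N by apply: trunc_log_ltn.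
  exact: (perfect_decomposition_large hc' (ltW c0) cm _ VJ nr hr kr pr lp hD).
split=> [hk hp V D|hk hp V D []].
  have h : r%:R ^+ 6 <= N `^ (2 / 5).
    apply: le_trans (rk 6%N) _; apply: (@le_trans _ _ (n%:R `^ (2 / 5))).
      exact: ler_powR.
    by apply: powR_mono; rewrite ?ler0n //; case: e0.
  by apply: main; rewrite ?hk; [|apply: le_trans hp]; apply: le_trans h _; rewrite ler_peMl ?powR_ge0 ?ler1n.
have np : n%:R `^ (- (1 / 3)) <= p.
  by apply: le_trans hp; rewrite ler_peMr ?powR_ge0 // exprn_ege1.
move=> hD _; apply: (main V D) => //.
  rewrite hk; apply: (@le_trans _ _ ((N ^+ 2 * p) `^ (1 / 5))); last by rewrite ler_peMl ?powR_ge0 ?ler1n.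
  apply: le_trans (rk 6%N) _; rewrite e2 powRrM.
  apply: powR_mono; rewrite ?powR_ge0 //; first by case: e0.
  apply: (@le_trans _ _ (n%:R ^+ 2 * n%:R `^ (- (1 / 3)))).
    rewrite -powR_mulrn ?ler0n // -powRD; last by rewrite pnatr_eq0 -lt0n n0 implybT.
    exact: ler_powR.
  by apply: ler_pM; rewrite ?exprn_ge0 ?powR_ge0 ?ler0n // lerXn2r ?nnegrE ?ler0n // (le_trans _ nN) ?ler0n.
apply: (@le_trans _ _ (n%:R * n%:R `^ (- (1 / 3)))); last by rewrite ler_wpM2l ?ler0n.
apply: le_trans (rk 6%N) _; rewrite -{2}[n%:R]powRr1 ?ler0n // -powRD; last by rewrite pnatr_eq0 -lt0n n0 implybT.
exact: ler_powR.
Qed.
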